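(* Let $\mathcal{A}$ be a unital algebra, let $q>0$, and let $(X,\pi,F)$ be a $q$-summable odd Banach Fredholm module over $\mathcal{A}$ with $\pi(1)=\mathrm{Id}_X$ and $F^2=\mathrm{Id}$. Let $\mathscr{B}$ be a class of Banach spaces stable under countable sums, containing the zero space and containing $X$. For any element $[u]$ of $\mathrm{K}_1(\mathcal{A})$ and any odd integer $n$ with $n+1\geq q$, we have $$\big\langle [u],[(X,\pi,F)]\big\rangle_{\mathrm{K}_1(\mathcal{A}),\mathrm{K}^1(\mathcal{A},\mathscr{B})}=\frac{(-1)^{\frac{n+1}{2}}}{4^{\frac{n+1}{2}}c_n}\,\mathrm{Ch}_n^F(u^{-1},u,\ldots,u^{-1},u).$$
   Context: An odd Banach Fredholm module $(X,\pi,F)$ over $\mathcal{A}$ consists of a complex Banach space $X$, an algebra homomorphism $\pi:\mathcal{A}\to\mathrm{B}(X)$ and a bounded operator $F$ on $X$ such that $F^2-\mathrm{Id}_X$ and all commutators $[F,\pi(a)]$, $a\in\mathcal{A}$, are compact. We write $[F,a]$ for $[F,\pi(a)]$. Approximation numbers of a bounded operator $T:X\to Y$ are $a_k(T)=\inf\{\|T-R\| : \mathrm{rank}\,R<k\}$, $k\ge1$. For $0<q<\infty$, $S^q_{\mathrm{app}}(X)$ is the set of bounded operators $T$ on $X$ with $(a_k(T))_{k\geq 1}\in\ell^q$. The trace $\mathrm{Tr}$ on finite-rank operators extends uniquely continuously to $S^1_{\mathrm{app}}(X)$. The module is $q$-summable if $[F,\pi(a)]\in S^q_{\mathrm{app}}(X)$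 for every $a\in\mathcal{A}$; then for $n+1\ge q$ every product of $n+1$ commutators $[F,a_0]\cdots[F,a_n]$ lies in $S^1_{\mathrm{app}}(X)$. For odd $n$ with $n+1\ge q$ the Chern character is $\mathrm{Ch}_n^F(a_0,\ldots,a_n)=c_n\,\mathrm{Tr}(F[F,a_0][F,a_1]\cdots[F,a_n])$, where $c_n\ne0$ is a fixed constant. If $u\in\mathrm{M}_k(\mathcal{A})$ is an invertible matrix, $\mathrm{Ch}_n^F(u^{-1},u,\ldots,u^{-1},u)$ is computed with the amplified module $(X^{\oplus k},\mathrm{Id}\otimes\pi,\mathrm{Id}\otimes F)$ over $\mathrm{M}_k(\mathcal{A})$. $\mathrm{K}_1(\mathcal{A})=\pi_0(\mathrm{GL}_\infty(\mathcal{A}))$ (for $\mathcal{A}$ a unital Banach algebra), and the class of an invertible $u\in\mathrm{M}_k(\mathcal{A})$ is denoted $[u]$. $\mathrm{K}^1(\mathcal{A},\mathscr{B})$ is the abelian group generated by isomorphism classes of odd Banach Fredholm modules on spaces of $\mathscr{B}$ modulo norm-continuous operator homotopy of $F$ ($X$ and $\pi$ fixed), additivity for direct sums, and vanishing of degenerate modules (those with $F^2=\mathrm{Id}$ and $[F,\pi(a)]=0$ for all $a$). The pairing is $\langle[u],[(X,\pi,F)]\rangle=\mathrm{Index}\big(P_k u_k P_k-(\mathrm{Id}-P_k)\big)$ on $X^{\oplus k}$, where $P_k=\mathrm{Id}\otimes\frac{\mathrm{Id}+F}{2}$ and $u_k=(\mathrm{Id}\otimes\pi)(u)$; when $F^2=\mathrm{Id}$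 this equals the index of $P_ku_kP_k:P_k(X^{\oplus k})\to P_k(X^{\oplus k})$. *)

(* Defs.v *)
From HB Require Import structures.
From mathcomp Require Import all_boot all_order all_algebra.
From mathcomp Require Import complex.
From mathcomp Require Import all_classical all_reals all_analysis.

Set Implicit Arguments.
Unset Strict Implicit.
Unset Printing Implicit Defensive.

Import Order.TTheory GRing.Theory Num.Theory.
Import numFieldNormedType.Exports.

Local Open Scope classical_set_scope.
Local Open Scope ring_scope.
Local Open Scope complex_scope.

(* The norm of a normed module over R[i] takes its values in R[i]; [nrm] is the
   same norm, read in R. *)
Definition nrm (R : realType) (X : normedModType R[i]) (x : X) : R :=
  complex.Re `|x|.

Section BoundedOperators.
Variables (R : realType) (X Y : normedModType R[i]).
Implicit Types T : X -> Y.

Definition op_bounds T : set R :=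
  [set M | 0 <= M /\ forall x, nrm (T x) <= M * nrm x].

Definition bounded_op T : Prop := linear T /\ op_bounds T !=set0.

Definition opnorm T : R := inf (op_bounds T).

Definition compact_op T : Prop :=
  bounded_op T /\ compact (closure (T @` [set x | `|x| <= 1])).

End BoundedOperators.

Section Dimension.
Variables (K : fieldType) (V : lmodType K).

(* dim (E / D) = n for subspaces D and E: the n vectors e i of E are a basis
   of E modulo D. *)
Definition has_dim_mod (E D : set V) (n : nat) : Prop :=
  exists e : 'I_n -> V,
    [/\ forall i, E (e i),
        forall c : 'I_n -> K, D (\sum_i c i *: e i) -> forall i, c i = 0 &
        forall v, E v -> exists c : 'I_n -> K, D (v - \sum_i c i *: e i)].

Definition has_dim (E : set V) (n : nat) : Prop := has_dim_mod E [set 0] n.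

Definition has_codim (D : set V) (n : nat) : Prop := has_dim_mod setT D n.

End Dimension.

(* The index of a linear operator with finite-dimensional kernel and finite
   codimensional range (the value is 0 for the other operators). *)
Definition has_index (K : fieldType) (V W : lmodType K) (T : V -> W) (z : int)
    : Prop :=
  exists m n : nat,
    [/\ has_dim [set v | T v = 0] m, has_codim (range T) n &
        z = m%:Z - n%:Z].

Definition fredholm_index (K : fieldType) (V W : lmodType K) (T : V -> W)
    : int :=
  xget 0 (has_index T).

Section Approximation.
Variables (R : realType) (X Y : normedModType R[i]).

Definition rank_lt (T : X -> Y) (k : nat) : Prop :=
  exists2 r : nat, (r < k)%N & has_dim (range T) r.

(* Only meaningful for 1 <= k, hence the shift of indices below. *)
Definition approx_number (k : nat) (T : X -> Y) : R :=
  inf [set opnorm (fun x => T x - S x) |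
       S in [set S : X -> Y | bounded_op S /\ rank_lt S k]].

Definition S_app (q : R) (T : X -> Y) : Prop :=
  bounded_op T /\ cvgn (series (fun k => approx_number k.+1 T `^ q)).

Definition S1_norm (T : X -> Y) : R :=
  limn (series (fun k => approx_number k.+1 T)).

End Approximation.

Section Trace.
Variables (R : realType) (X : normedModType R[i]).

Definition has_finite_trace (T : X -> X) (t : R[i]) : Prop :=
  exists (m : nat) (phi : 'I_m -> X -> R[i]^o) (x : 'I_m -> X),
    [/\ forall i, bounded_op (phi i),
        forall y, T y = \sum_i phi i y *: x i &
        t = \sum_i phi i (x i)].

Definition trace_extension (tau : (X -> X) -> R[i]) : Prop :=
  (forall T t, has_finite_trace T t -> tau T = t) /\
  (forall T : X -> X, S_app 1 T -> forall e : R, 0 < e ->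
     exists2 d : R, 0 < d &
       forall S : X -> X, S_app 1 S -> S1_norm (fun x => S x - T x) < d ->
         `|tau S - tau T| < e%:C).

(* All trace extensions agree on S_app 1, where finite-rank operators are
   dense; outside S_app 1 the value is irrelevant. *)
Definition app_trace : (X -> X) -> R[i] := xget (fun=> 0) trace_extension.

End Trace.

Definition commutator (X : zmodType) (S T : X -> X) : X -> X :=
  fun x => S (T x) - T (S x).

(* F [F, p 0] [F, p 1] ... [F, p n] *)
Definition chern_product (X : zmodType) (F : X -> X) (n : nat)
    (p : 'I_n.+1 -> X -> X) : X -> X :=
  F \o \big[(fun S T : X -> X => S \o T)/idfun]_(i < n.+1) commutator F (p i).

(* Ch_n^F(a_0, ..., a_n) with normalisation constant c, for an algebra Alg
   represented by pi on X. *)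
Definition chern_character (R : realType) (Alg : Type)
    (X : normedModType R[i]) (c : R[i]) (pi : Alg -> X -> X) (F : X -> X)
    (n : nat) (a : 'I_n.+1 -> Alg) : R[i] :=
  c * app_trace (chern_product F (fun i => pi (a i))).

(* The direct sum of k copies of X, with the sum norm (all the usual norms are
   equivalent). *)
Definition dsum (R : realType) (X : normedModType R[i]) (k : nat) : Type :=
  {ffun 'I_k -> X}.

Section DirectSumNorm.
Variables (R : realType) (X : normedModType R[i]) (k : nat).

HB.instance Definition _ := GRing.Lmodule.on (dsum X k).

Let dsum_norm (x : dsum X k) : R[i] := \sum_i `|(x : {ffun 'I_k -> X}) i|.

Let dsum_normD (x y : dsum X k) :
  dsum_norm (x + y) <= dsum_norm x + dsum_norm y.
Proof.
rewrite /dsum_norm -big_split /=; apply: ler_sum => i _.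
by rewrite ffunE ler_normD.
Qed.

Let dsum_normZ (l : R[i]) (x : dsum X k) :
  dsum_norm (l *: x) = `|l| * dsum_norm x.
Proof.
rewrite /dsum_norm mulr_sumr; apply: eq_bigr => i _.
by rewrite ffunE normrZ.
Qed.

Let dsum_norm_eq0 (x : dsum X k) : dsum_norm x = 0 -> x = 0.
Proof.
move=> /eqP; rewrite psumr_eq0 => [/allP x0|i _]; last exact: normr_ge0.
apply/ffunP => i; rewrite ffunE; apply/eqP; rewrite -normr_eq0.
by apply: x0; rewrite mem_index_enum.
Qed.

HB.instance Definition _ := Lmodule_isNormed.Build R[i] (dsum X k)
  dsum_normD dsum_normZ dsum_norm_eq0.

End DirectSumNorm.

(* Id (x) F and (Id (x) pi)(u) on the direct sum of k copies of X *)
Definition amplify_op (R : realType) (X : normedModType R[i]) (k : nat)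
    (F : X -> X) : dsum X k -> dsum X k :=
  fun x => [ffun i => F (x i)].

Definition amplify_rep (R : realType) (Alg : Type) (X : normedModType R[i])
    (k : nat) (pi : Alg -> X -> X) (u : 'M[Alg]_k) : dsum X k -> dsum X k :=
  fun x => [ffun i => \sum_j pi (u i j) (x j)].

Section FredholmModules.
Variables (R : realType) (A : algType R[i]).

Record odd_fredholm_module (X : completeNormedModType R[i]) := OddFredholm {
  fm_rep : A -> X -> X;
  fm_op : X -> X;
  fm_rep_bounded : forall a, bounded_op (fm_rep a);
  fm_rep_linear : forall (l : R[i]) a b x,
    fm_rep (l *: a + b) x = l *: fm_rep a x + fm_rep b x;
  fm_rep_mul : forall a b x, fm_rep (a * b) x = fm_rep a (fm_rep b x);
  fm_op_bounded : bounded_op fm_op;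
  fm_op_sqr : compact_op (fun x => fm_op (fm_op x) - x);
  fm_op_comm : forall a, compact_op (commutator fm_op (fm_rep a)) }.

Definition q_summable (q : R) (X : completeNormedModType R[i])
    (M : odd_fredholm_module X) : Prop :=
  forall a, S_app q (commutator (fm_op M) (fm_rep M a)).

Definition unital_module (X : completeNormedModType R[i])
    (M : odd_fredholm_module X) : Prop :=
  forall x, fm_rep M 1 x = x.

Definition symmetry_module (X : completeNormedModType R[i])
    (M : odd_fredholm_module X) : Prop :=
  forall x, fm_op M (fm_op M x) = x.

Definition degenerate_module (X : completeNormedModType R[i])
    (M : odd_fredholm_module X) : Prop :=
  symmetry_module M /\
  forall a x, commutator (fm_op M) (fm_rep M a) x = 0.

Definition intertwines (X Y : completeNormedModType R[i])
    (M : odd_fredholm_module X) (N : odd_fredholm_module Y) (T : X -> Y)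
    : Prop :=
  (forall a x, T (fm_rep M a x) = fm_rep N a (T x)) /\
  (forall x, T (fm_op M x) = fm_op N (T x)).

Definition module_iso (X Y : completeNormedModType R[i])
    (M : odd_fredholm_module X) (N : odd_fredholm_module Y) : Prop :=
  exists (T : X -> Y) (S : Y -> X),
    [/\ bounded_op T, bounded_op S, cancel T S, cancel S T &
        intertwines M N T].

Definition module_dsum (X X1 X2 : completeNormedModType R[i])
    (M : odd_fredholm_module X) (M1 : odd_fredholm_module X1)
    (M2 : odd_fredholm_module X2) : Prop :=
  exists (i1 : X1 -> X) (i2 : X2 -> X) (p1 : X -> X1) (p2 : X -> X2),
    [/\ [/\ bounded_op i1, bounded_op i2, bounded_op p1 & bounded_op p2],
        cancel i1 p1, cancel i2 p2,
        forall x, i1 (p1 x) + i2 (p2 x) = x &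
        intertwines M1 M i1 /\ intertwines M2 M i2].

(* A path of modules with the same X and pi, and norm-continuous F. *)
Definition operator_homotopy (X : completeNormedModType R[i])
    (M : R -> odd_fredholm_module X) : Prop :=
  (forall t a x, fm_rep (M t) a x = fm_rep (M 0) a x) /\
  (forall s, s \in `[0, 1] -> forall e : R, 0 < e ->
     exists2 d : R, 0 < d & forall t, t \in `[0, 1] -> `|t - s| < d ->
       opnorm (fun x => fm_op (M t) x - fm_op (M s) x) < e).

(* Invertible matrices over A, with their inverse. *)
Record GL := mkGL {
  gl_size : nat;
  gl_mx : 'M[A]_gl_size;
  gl_inv : 'M[A]_gl_size;
  gl_mulV : gl_mx *m gl_inv = 1%:M;
  gl_mulVl : gl_inv *m gl_mx = 1%:M }.

(* P_k u_k P_k - (Id - P_k) with P_k = (Id + F_k) / 2 *)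
Definition toeplitz_op (X : completeNormedModType R[i])
    (M : odd_fredholm_module X) (k : nat) (u : 'M[A]_k)
    : dsum X k -> dsum X k :=
  let P : dsum X k -> dsum X k :=
    fun x => 2%:R^-1 *: (x + amplify_op (fm_op M) x) in
  fun x => P (amplify_rep (fm_rep M) u (P x)) - (x - P x).

Definition index_pairing (u : GL) (X : completeNormedModType R[i])
    (M : odd_fredholm_module X) : int :=
  fredholm_index (toeplitz_op M (gl_mx u)).

End FredholmModules.

Section BanachClasses.
Variables (R : realType) (B : completeNormedModType R[i] -> Prop).

(* Y is a direct sum of the sequence Xs, for whichever norm is used on the sum:
   Y contains complemented copies of the Xs i, in which each vector of Y has a
   convergent expansion. *)
Definition countable_sum (Xs : nat -> completeNormedModType R[i])
    (Y : completeNormedModType R[i]) : Prop :=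
  exists (i_ : forall n, Xs n -> Y) (p_ : forall n, Y -> Xs n),
    [/\ forall n, bounded_op (i_ n) /\ bounded_op (p_ n),
        forall n, cancel (i_ n) (p_ n),
        forall m n x, m != n -> p_ m (i_ n x) = 0 &
        forall y, series (fun n => i_ n (p_ n y)) @ \oo --> y].

Definition stable_countable_sums : Prop :=
  forall Xs : nat -> completeNormedModType R[i], (forall n, B (Xs n)) ->
  exists2 Y, B Y & countable_sum Xs Y.

Definition contains_zero_space : Prop :=
  exists2 Z : completeNormedModType R[i], B Z & forall z : Z, z = 0.

End BanachClasses.

Section KHomology.
Variables (R : realType) (A : algType R[i]).
Variable B : completeNormedModType R[i] -> Prop.

Record module_over := ModuleOver {
  mo_space : completeNormedModType R[i];
  mo_space_in : B mo_space;
  mo_module : odd_fredholm_module A mo_space }.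

(* The free abelian group on the modules is presented by words in signed
   generators, true standing for the sign +. *)
Definition formal_sum := seq (bool * module_over).

Inductive K1hom_eq : formal_sum -> formal_sum -> Prop :=
| K1hom_refl x : K1hom_eq x x
| K1hom_sym x y : K1hom_eq x y -> K1hom_eq y x
| K1hom_trans x y z : K1hom_eq x y -> K1hom_eq y z -> K1hom_eq x z
| K1hom_cat x x' y y' :
    K1hom_eq x x' -> K1hom_eq y y' -> K1hom_eq (x ++ y) (x' ++ y')
| K1hom_comm x y : K1hom_eq (x ++ y) (y ++ x)
| K1hom_opp b M : K1hom_eq [:: (b, M); (~~ b, M)] [::]
| K1hom_iso M N : module_iso (mo_module M) (mo_module N) ->
    K1hom_eq [:: (true, M)] [:: (true, N)]
| K1hom_homotopy X (BX : B X) (M : R -> odd_fredholm_module A X) :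
    operator_homotopy M ->
    K1hom_eq [:: (true, ModuleOver BX (M 0))]
             [:: (true, ModuleOver BX (M 1))]
| K1hom_dsum M M1 M2 :
    module_dsum (mo_module M) (mo_module M1) (mo_module M2) ->
    K1hom_eq [:: (true, M)] [:: (true, M1); (true, M2)]
| K1hom_degenerate M : degenerate_module (mo_module M) ->
    K1hom_eq [:: (true, M)] [::].

(* The group K^1(A, B): classes of formal sums; the sum of classes is induced
   by concatenation. *)
Definition K1hom : Type :=
  {c : formal_sum -> Prop | exists x, c = K1hom_eq x}.

Definition K1hom_of_sum (x : formal_sum) : K1hom :=
  exist _ (K1hom_eq x) (ex_intro _ x erefl).

Definition K1hom_class (M : module_over) : K1hom :=
  K1hom_of_sum [:: (true, M)].

End KHomology.

Section KTheory.
Variables (R : realType) (A : algType R[i]).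

Record banach_algebra_norm := BanachAlgebraNorm {
  alg_norm :> A -> R;
  alg_norm_eq0 : forall a, alg_norm a = 0 -> a = 0;
  alg_normD : forall a b, alg_norm (a + b) <= alg_norm a + alg_norm b;
  alg_normZ : forall (l : R[i]) a,
    alg_norm (l *: a) = complex.Re `|l| * alg_norm a;
  alg_normM : forall a b, alg_norm (a * b) <= alg_norm a * alg_norm b;
  alg_norm_complete : forall a_ : nat -> A,
    (forall e, 0 < e -> exists m, forall i j, (m <= i)%N -> (m <= j)%N ->
       alg_norm (a_ i - a_ j) < e) ->
    exists a, forall e, 0 < e -> exists m, forall i, (m <= i)%N ->
       alg_norm (a_ i - a) < e }.

Variable N : banach_algebra_norm.

(* For k <= m, the image of u in M_m(A): u completed by an identity block. *)
Definition gl_pad (m k : nat) (u : 'M[A]_k) : 'M[A]_m :=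
  \matrix_(i, j)
    match insub (val i) : option 'I_k, insub (val j) : option 'I_k with
    | Some i', Some j' => u i' j'
    | _, _ => (i == j)%:R
    end.

Definition GL_path (m : nat) (p : R -> 'M[A]_m) : Prop :=
  (forall t, t \in `[0, 1] ->
     exists v, p t *m v = 1%:M /\ v *m p t = 1%:M) /\
  (forall i j s, s \in `[0, 1] -> forall e : R, 0 < e ->
     exists2 d : R, 0 < d & forall t, t \in `[0, 1] -> `|t - s| < d ->
       N (p t i j - p s i j) < e).

(* Two invertible matrices lie in the same path component of GL_infty(A). *)
Definition K1_eq (u v : GL A) : Prop :=
  exists m (p : R -> 'M[A]_m),
    [/\ (gl_size u <= m)%N, (gl_size v <= m)%N, GL_path p,
        p 0 = gl_pad m (gl_mx u) & p 1 = gl_pad m (gl_mx v)].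

Definition K1 : Type := {c : GL A -> Prop | exists u, c = K1_eq u}.

Definition K1_class (u : GL A) : K1 :=
  exist _ (K1_eq u) (ex_intro _ u erefl).

(* The pairing of K_1(A) with K^1(A, B): additive in the second variable, and
   given by the index on the classes of matrices and of unital modules (if
   pi(1) is not the identity, the operator P_k u_k P_k - (Id - P_k) need not be
   Fredholm). *)
Definition is_K_pairing (B : completeNormedModType R[i] -> Prop)
    (pairing : K1 -> K1hom A B -> int) : Prop :=
  (forall c x y, pairing c (K1hom_of_sum (x ++ y)) =
     pairing c (K1hom_of_sum x) + pairing c (K1hom_of_sum y)) /\
  (forall u (M : module_over A B), unital_module (mo_module M) ->
     pairing (K1_class u) (K1hom_class M) = index_pairing u (mo_module M)).

End KTheory.

(* Main.v *)
Require Import Defs.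
From HB Require Import structures.
From mathcomp Require Import all_boot all_order all_algebra.
From mathcomp Require Import complex.
From mathcomp Require Import all_classical all_reals all_analysis.
From mathcomp Require Import ring lra.

Set Implicit Arguments.
Unset Strict Implicit.
Unset Printing Implicit Defensive.

Import Order.TTheory GRing.Theory Num.Theory.
Import numFieldNormedType.Exports.

Local Open Scope classical_set_scope.
Local Open Scope ring_scope.
Local Open Scope complex_scope.

(** Write Y for the direct sum of k copies of X, P = (1 + F) / 2 for the
projection attached to the amplified symmetry F, U and V = U^-1 for the operators
of u and its inverse, and let m = (n + 1) / 2. In 2 x 2 blocks relative to
1 = P + (1 - P), commutators with F are off-diagonal:
[F, W] = 2 (P W (1 - P) - (1 - P) W P). Hence F ([F, V] [F, U])^m is the diagonal
operator (-4)^m (x^m - y^m), with x = P V (1 - P) U P and y = (1 - P) V P U (1 - P)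
([chern_corners]). On the other side T = P U P - (1 - P) has the parametrix
P V P - (1 - P), with errors x and z = P U (1 - P) V P; multiplied by a partial
Neumann sum, it becomes a parametrix S with 1 - S T = x^m and 1 - T S = z^m
([toeplitz_parametrix]). Moreover y^m and z^m have the same trace, being the
products of the same two factors in opposite orders. The theorem is therefore
the formula  index T = Tr (1 - S T) - Tr (1 - T S)  ([has_index_trace]).

That formula is linear algebra when both errors have finite rank: T and S exchange
the finite-dimensional ranges of the errors, the index of T is the difference of
the dimensions of these ranges, and Tr (st) = Tr (ts) for the matrices s and t of
S and T between them ([has_index_finite_rank]). For trace-class errors, S is
corrected by a trace-class operator d, obtained by inverting 1 minus a small
operator on the complete space Y, so that the new errors have finite rank; the two
traces change by Tr (d T) and Tr (T d), which agree.

What remains is the trace itself. The trace of an operator of rank at most k is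
bounded by k times its norm, since it is a sum of at most k nonzero eigenvalues
([trace_bound]); this also shows that it does not depend on the way in which the
operator is written. Splitting an operator into differences of its approximants of
ranks 1, 2, 4, ... bounds its trace by the sum of its approximation numbers
([rank_trace_tclass]), so that the trace extends continuously from the finite-rank
operators, and [app_trace] is this extension ([app_traceE]). Cyclicity passes to
the limit because an operator A can be approximated by finite-rank operators Q in
such a way that (A - Q) B and B (A - Q) are both small in the trace class
([appr_density]).

Approximation numbers are handled through error sequences: [appr c s T] says that
T is within s_k of the operators of rank c k. Under sums the sequences add, under
products they multiply, whence the trace class property of a product of n + 1
commutators. *)

(** * Real-valued norms and completeness *)

Section RealNorm.
Variable R : realType.

Definition cabs (a : R[i]) : R := complex.Re `|a|.

Lemma normcE (a : R[i]) : `|a| = (cabs a)%:C.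
Proof. by rewrite /cabs normc_def. Qed.

Lemma normc_lt (a : R[i]) (e : R) : (`|a| < e%:C) = (cabs a < e).
Proof. by rewrite normcE ltcR. Qed.

Lemma cabs_ge0 a : 0 <= cabs a.
Proof. by rewrite -lecR -normcE normr_ge0. Qed.

Lemma cabsD a b : cabs (a + b) <= cabs a + cabs b.
Proof. by rewrite -lecR rmorphD /= -!normcE ler_normD. Qed.

Lemma cabsN a : cabs (- a) = cabs a.
Proof. by rewrite /cabs normrN. Qed.

Lemma cabsB a b : cabs (a - b) <= cabs a + cabs b.
Proof. by rewrite -(cabsN b) cabsD. Qed.

Lemma cabsM a b : cabs (a * b) = cabs a * cabs b.
Proof. by apply: complexI; rewrite rmorphM /= -!normcE normrM. Qed.

Lemma cabs0 : cabs 0 = 0.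
Proof. by rewrite /cabs normr0. Qed.

Lemma cabs_eq0 a : cabs a = 0 -> a = 0.
Proof. by move=> h; apply/normr0_eq0; rewrite normcE h. Qed.

Lemma cabs_sum (I : Type) (r : seq I) (P : pred I) (F : I -> R[i]) :
  cabs (\sum_(i <- r | P i) F i) <= \sum_(i <- r | P i) cabs (F i).
Proof.
elim/big_rec2: _ => [|i x y _ h]; first by rewrite cabs0.
by rewrite (le_trans (cabsD _ _))// lerD2l.
Qed.

Lemma ler_Re_cabs z : `|complex.Re z| <= cabs z.
Proof. by rewrite -lecR -normcE normc_ge_Re. Qed.

Lemma ler_Im_cabs z : `|complex.Im z| <= cabs z.
Proof.
suff -> : `|complex.Im z| = `|complex.Re (z * 'i)|.
  rewrite (le_trans (ler_Re_cabs _))// cabsM.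
  have -> : cabs 'i = 1 by rewrite /cabs normc_def /= expr0n /= add0r expr1n sqrtr1.
  by rewrite mulr1.
by case: z => a b /=; rewrite mulr0 mulr1 sub0r normrN.
Qed.

Lemma cabs_le_ReIm z : cabs z <= `|complex.Re z| + `|complex.Im z|.
Proof.
case: z => a b /=.
have -> : a +i* b = a%:C + b%:C * 'i.
  by apply/eqP; rewrite eq_complex /=; apply/andP; split; apply/eqP; ring.
apply: le_trans (cabsD _ _) _; rewrite cabsM.
have -> : cabs 'i = 1 by rewrite /cabs normc_def /= expr0n /= add0r expr1n sqrtr1.
rewrite mulr1; apply: lerD.
  by rewrite /cabs normc_def /= expr0n /= addr0 sqrtr_sqr.
by rewrite /cabs normc_def /= expr0n /= addr0 sqrtr_sqr.
Qed.

Section Module.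
Variable X : normedModType R[i].
Implicit Types x y : X.

Lemma nrmE x : `|x| = (nrm x)%:C.
Proof.
rewrite /nrm; have : 0 <= `|x| by rewrite normr_ge0.
by case: (`|x|) => a b; rewrite lecE /= => /andP[/eqP -> _].
Qed.

Lemma nrm_ge0 x : 0 <= nrm x.
Proof. by rewrite -lecR -nrmE normr_ge0. Qed.

Lemma nrmD x y : nrm (x + y) <= nrm x + nrm y.
Proof. by rewrite -lecR rmorphD /= -!nrmE ler_normD. Qed.

Lemma nrmN x : nrm (- x) = nrm x.
Proof. by rewrite /nrm normrN. Qed.

Lemma nrmB x y : nrm (x - y) <= nrm x + nrm y.
Proof. by rewrite -(nrmN y) nrmD. Qed.

Lemma nrmZ a x : nrm (a *: x) = cabs a * nrm x.
Proof. by apply: complexI; rewrite rmorphM /= -nrmE -normcE -nrmE normrZ. Qed.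

Lemma nrm0 : nrm (0 : X) = 0.
Proof. by rewrite /nrm normr0. Qed.

Lemma nrm_eq0 x : nrm x = 0 -> x = 0.
Proof. by move=> h; apply/normr0_eq0; rewrite nrmE h. Qed.

Lemma nrm_gt0 x : x != 0 -> 0 < nrm x.
Proof.
move=> x0; rewrite lt0r nrm_ge0 andbT.
by apply: contra_neq x0 => /nrm_eq0.
Qed.

Lemma nrm_sum (I : Type) (r : seq I) (P : pred I) (F : I -> X) :
  nrm (\sum_(i <- r | P i) F i) <= \sum_(i <- r | P i) nrm (F i).
Proof.
elim/big_rec2: _ => [|i x y _ h]; first by rewrite nrm0.
by rewrite (le_trans (nrmD _ _))// lerD2l.
Qed.

End Module.

(** Completeness in terms of sequences and of the real-valued norm, so that it can
   be checked coordinatewise on a direct sum. *)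
Definition nrm_complete (Y : normedModType R[i]) : Prop :=
  forall u : nat -> Y,
  (forall e : R, 0 < e -> exists N, forall i j, (N <= i)%N -> (N <= j)%N ->
     nrm (u i - u j) < e) ->
  exists l, forall e : R, 0 < e -> exists N, forall i, (N <= i)%N ->
     nrm (u i - l) < e.

End RealNorm.

Lemma cauchy_seq_limit (K : numFieldType) (V : completeNormedModType K)
    (u : nat -> V) :
  (forall e : K, 0 < e -> exists N, forall i j, (N <= i)%N -> (N <= j)%N ->
     `|u i - u j| < e) ->
  exists l, forall e : K, 0 < e -> exists N, forall i, (N <= i)%N ->
     `|u i - l| < e.
Proof.
move=> uC; have /cauchy_cvgP/cvg_ex [l ul] : cauchy (u @ \oo).
  apply/cauchyP => e /uC [N uN]; exists (u N).
  by exists N => // i /= Ni; rewrite -ball_normE /ball_ /=; apply: uN.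
exists l => e e0; move/cvgrPdist_lt : ul => /(_ e e0) [N _ uN].
by exists N => i Ni; rewrite distrC; apply: uN.
Qed.

Lemma complete_nrm_complete (R : realType) (X : completeNormedModType R[i]) :
  nrm_complete X.
Proof.
move=> u uC; have [|l ul] := @cauchy_seq_limit _ _ u.
  move=> e e0; have eE : e = (complex.Re e)%:C.
    by apply/eqP; rewrite eq_complex /= eqxx /= eq_sym; move: e0; rewrite ltcE /= => /andP[/eqP ->].
  have /uC[N uN] : 0 < complex.Re e by rewrite -ltcR -eE.
  by exists N => i j Ni Nj; rewrite nrmE eE ltcR uN.
exists l => e e0; have /ul[N uN] : 0 < e%:C :> R[i] by rewrite ltcR.
by exists N => i /uN; rewrite nrmE ltcR.
Qed.

Lemma complex_nrm_complete (R : realType) : nrm_complete (R[i]^o).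
Proof.
move=> u uC.
have [|a ua] := @cauchy_seq_limit _ (R^o) (fun n => complex.Re (u n)).
  move=> e /uC[N uN]; exists N => i j Ni Nj; apply: le_lt_trans (uN i j Ni Nj).
  by rewrite -raddfB; apply: ler_Re_cabs.
have [|b ub] := @cauchy_seq_limit _ (R^o) (fun n => complex.Im (u n)).
  move=> e /uC[N uN]; exists N => i j Ni Nj; apply: le_lt_trans (uN i j Ni Nj).
  by rewrite -raddfB; apply: ler_Im_cabs.
exists (a +i* b) => e e0.
have e20 : 0 < e / 2 by rewrite divr_gt0.
have [N uN] := ua _ e20; have [N' uN'] := ub _ e20.
exists (maxn N N') => i; rewrite geq_max => /andP[Ni N'i].
apply: le_lt_trans (cabs_le_ReIm _) _; rewrite (splitr e); apply: ltrD.
  by have := uN i Ni; case: (u i).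
by have := uN' i N'i; case: (u i).
Qed.

(** * Bounded operators *)

Lemma subrACA (V : zmodType) (a b c d : V) : a - b - (c - d) = a - c - (b - d).
Proof. by rewrite !opprB addrACA [RHS]addrACA [- b - c]addrC. Qed.

Lemma subKr_diff (V : zmodType) (a b : V) : a - (a - b) = b.
Proof. by rewrite opprB addrC subrK. Qed.

Section LinearMaps.
Variables (K : pzRingType) (U V : lmodType K) (T : U -> V).
Hypothesis T_lin : linear T.

Lemma lin0 : T 0 = 0.
Proof. by have := T_lin (-1) 0 0; rewrite scaler0 addr0 scaleN1r addNr. Qed.

Lemma linD x y : T (x + y) = T x + T y.
Proof. by have := T_lin 1 x y; rewrite !scale1r. Qed.

Lemma linZ a x : T (a *: x) = a *: T x.
Proof. by have := T_lin a x 0; rewrite !addr0 lin0 addr0. Qed.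

Lemma linN x : T (- x) = - T x.
Proof. by rewrite -scaleN1r linZ scaleN1r. Qed.

Lemma linB x y : T (x - y) = T x - T y.
Proof. by rewrite linD linN. Qed.

Lemma lin_sum (I : Type) (r : seq I) (P : pred I) (F : I -> U) :
  T (\sum_(i <- r | P i) F i) = \sum_(i <- r | P i) T (F i).
Proof. exact: (big_morph T linD lin0). Qed.

End LinearMaps.

Section Bounds.
Variable R : realType.

Definition opb (X Y : normedModType R[i]) (T : X -> Y) (M : R) : Prop :=
  forall x, nrm (T x) <= M * nrm x.

Lemma bounded_opP (X Y : normedModType R[i]) (T : X -> Y) :
  bounded_op T <-> linear T /\ exists2 M : R, 0 <= M & opb T M.
Proof.
by split=> [[lT [M [M0 TM]]]|[lT [M M0 TM]]]; split => //; exists M.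
Qed.

Lemma opb_le (X Y : normedModType R[i]) (T : X -> Y) (M N : R) :
  M <= N -> opb T M -> opb T N.
Proof.
by move=> MN TM x; apply: le_trans (TM x) _; rewrite ler_wpM2r ?nrm_ge0.
Qed.

Lemma opb0 (X Y : normedModType R[i]) : opb (0 : X -> Y) 0.
Proof. by move=> x; rewrite nrm0 mul0r. Qed.

Lemma opbD (X Y : normedModType R[i]) (S T : X -> Y) M N :
  opb S M -> opb T N -> opb (S + T) (M + N).
Proof.
by move=> SM TN x; apply: le_trans (nrmD _ _) _; rewrite mulrDl lerD.
Qed.

Lemma opbN (X Y : normedModType R[i]) (T : X -> Y) M : opb T M -> opb (- T) M.
Proof. by move=> TM x; rewrite nrmN; apply: TM. Qed.

Lemma opbB (X Y : normedModType R[i]) (S T : X -> Y) M N :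
  opb S M -> opb T N -> opb (S - T) (M + N).
Proof. by move=> SM TN; apply: opbD => //; apply: opbN. Qed.

Lemma opb_comp (X Y Z : normedModType R[i]) (S : Y -> Z) (T : X -> Y) M N :
  0 <= M -> opb S M -> opb T N -> opb (S \o T) (M * N).
Proof.
move=> M0 SM TN x; apply: le_trans (SM _) _.
by rewrite -mulrA ler_wpM2l.
Qed.

Lemma linear_op0 (X Y : normedModType R[i]) : linear (0 : X -> Y).
Proof. by move=> a x y; rewrite scaler0 addr0. Qed.

Lemma linear_opD (X Y : normedModType R[i]) (S T : X -> Y) :
  linear S -> linear T -> linear (S + T).
Proof.
move=> lS lT a x y; rewrite !fctE /= lS lT.
by rewrite scalerDr addrACA.
Qed.

Lemma linear_opN (X Y : normedModType R[i]) (T : X -> Y) :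
  linear T -> linear (- T).
Proof. by move=> lT a x y; rewrite !fctE /= lT opprD scalerN. Qed.

Lemma linear_opB (X Y : normedModType R[i]) (S T : X -> Y) :
  linear S -> linear T -> linear (S - T).
Proof. by move=> lS lT; apply: linear_opD => //; apply: linear_opN. Qed.

Lemma linear_op_comp (X Y Z : normedModType R[i]) (S : Y -> Z) (T : X -> Y) :
  linear S -> linear T -> linear (S \o T).
Proof. by move=> lS lT a x y; rewrite /= lT lS. Qed.

Lemma bounded0 (X Y : normedModType R[i]) : bounded_op (0 : X -> Y).
Proof. by apply/bounded_opP; split; [exact: linear_op0 | exists 0; [|exact: opb0]]. Qed.

Lemma boundedD (X Y : normedModType R[i]) (S T : X -> Y) :
  bounded_op S -> bounded_op T -> bounded_op (S + T).
Proof.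
move=> /bounded_opP[lS [M M0 SM]] /bounded_opP[lT [N N0 TN]].
apply/bounded_opP; split; first exact: linear_opD.
by exists (M + N); [exact: addr_ge0|exact: opbD].
Qed.

Lemma boundedN (X Y : normedModType R[i]) (T : X -> Y) :
  bounded_op T -> bounded_op (- T).
Proof.
move=> /bounded_opP[lT [N N0 TN]]; apply/bounded_opP; split; first exact: linear_opN.
by exists N => //; apply: opbN.
Qed.

Lemma boundedB (X Y : normedModType R[i]) (S T : X -> Y) :
  bounded_op S -> bounded_op T -> bounded_op (S - T).
Proof. by move=> bS bT; apply: boundedD => //; apply: boundedN. Qed.

Lemma bounded_comp (X Y Z : normedModType R[i]) (S : Y -> Z) (T : X -> Y) :
  bounded_op S -> bounded_op T -> bounded_op (S \o T).
Proof.
move=> /bounded_opP[lS [M M0 SM]] /bounded_opP[lT [N N0 TN]].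
apply/bounded_opP; split; first exact: linear_op_comp.
by exists (M * N); [exact: mulr_ge0|exact: opb_comp].
Qed.

Lemma bounded_id (X : normedModType R[i]) : bounded_op (idfun : X -> X).
Proof. by apply/bounded_opP; split=> //; exists 1 => // x; rewrite mul1r. Qed.

Lemma boundedZ (X Y : normedModType R[i]) a (T : X -> Y) :
  bounded_op T -> bounded_op (fun x => a *: T x).
Proof.
move=> /bounded_opP[lT [N N0 TN]]; apply/bounded_opP; split.
  by move=> b x y; rewrite lT scalerDr !scalerA mulrC.
exists (cabs a * N); first by rewrite mulr_ge0 ?cabs_ge0.
by move=> x; rewrite nrmZ -mulrA ler_wpM2l ?cabs_ge0.
Qed.

(** The solution of v - D v = y is the limit of the iterates of v |-> y + D v. *)
Lemma neumann_inverse (Y : normedModType R[i]) (D : Y -> Y) :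
  nrm_complete Y -> linear D -> opb D 2^-1 ->
  exists G : Y -> Y, [/\ bounded_op G, forall y, G (y - D y) = y
    & forall y, G y - D (G y) = y].
Proof.
move=> cY lD D2.
pose z y n := iter n (fun v => y + D v) 0.
have z_bound y n : nrm (z y n) <= 2 * nrm y.
  elim: n => [|n IH]; first by rewrite nrm0 mulr_ge0 ?nrm_ge0.
  rewrite /z iterS -/(z y n); apply: le_trans (nrmD _ _) _.
  by have := D2 (z y n); lra.
have z_dist y n j : nrm (z y (n + j)%N - z y n) <= 2^-1 ^+ n * (2 * nrm y).
  elim: n => [|n IH]; first by rewrite add0n subr0 expr0 mul1r.
  rewrite /z addSn !iterS -/(z y n) -/(z y _).
  have -> : y + D (z y (n + j)%N) - (y + D (z y n)) = D (z y (n + j)%N - z y n).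
    by rewrite (linB lD) opprD addrACA subrr add0r.
  apply: le_trans (D2 _) _; rewrite exprS -mulrA ler_wpM2l//.
have z_lim y : exists v, v - D v = y.
  have [|v yv] := cY (z y).
    move=> e e0.
    have [N NP] : exists N, 2^-1 ^+ N * (2 * nrm y) < e / 2.
      have y1 : 0 < 2 * nrm y + 1 by rewrite ltr_wpDl// mulr_ge0 ?nrm_ge0.
      have := @cvg_expr R (2^-1).
      rewrite ger0_norm// invf_lt1// ltr1n => /(_ isT) /cvgrPdist_lt.
      move=> /(_ (e / 2 / (2 * nrm y + 1))); rewrite !divr_gt0// => /(_ isT).
      move=> [N _ /(_ N (leqnn N))]; rewrite /= sub0r normrN ger0_norm ?exprn_ge0//.
      rewrite ltr_pdivlMr// => h; exists N; apply: le_lt_trans h.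
      by rewrite ler_wpM2l ?exprn_ge0// lerDl.
    exists N => i j Ni Nj; rewrite -(subnKC Ni) -(subnKC Nj).
    have -> : z y (N + (i - N))%N - z y (N + (j - N))%N =
      (z y (N + (i - N))%N - z y N) - (z y (N + (j - N))%N - z y N).
      by rewrite opprB addrA subrK.
    apply: le_lt_trans (nrmB _ _) _.
    by have := z_dist y N (i - N)%N; have := z_dist y N (j - N)%N; lra.
  exists v; apply/eqP; rewrite -subr_eq0; apply/eqP/nrm_eq0/eqP.
  rewrite eq_le nrm_ge0 andbT; apply/ler_addgt0Pl => e e0; rewrite addr0.
  have e20 : 0 < e / 2 by rewrite divr_gt0.
  have [N NP] := yv _ e20.
  have -> : v - D v - y = D (z y N - v) - (z y N.+1 - v).
    by rewrite /z iterS -/(z y N) (linB lD) opprB [RHS]addrC opprD !addrA subrK addrAC.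
  apply: le_trans (nrmB _ _) _.
  have := D2 (z y N - v); have := NP N (leqnn N); have := NP N.+1 (leqnSn N); have := nrm_ge0 (z y N - v); lra.
have D_inj v : v - D v = 0 -> v = 0.
  move=> /eqP; rewrite subr_eq0 => /eqP vD; apply/nrm_eq0/eqP.
  rewrite eq_le nrm_ge0 andbT.
  by have := D2 v; rewrite -vD; lra.
have [G GP] := choice z_lim.
have Guniq v y : v - D v = y -> G y = v.
  move=> vy; apply/eqP; rewrite -subr_eq0; apply/eqP/D_inj.
  by rewrite (linB lD) opprB [D v - _]addrC addrACA GP [- v + _]addrC -opprB vy subrr.
exists G; split => //; last by move=> y; apply: Guniq.
apply/bounded_opP; split.
  move=> a x y; apply: Guniq; by rewrite lD opprD addrACA -scalerBr !GP.
exists 2 => // y; have := GP y => /(congr1 (@nrm _ _)) yE.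
have h1 : nrm (G y) <= nrm (G y - D (G y)) + nrm (D (G y)).
  by apply: le_trans (nrmD _ _); rewrite subrK.
by have := D2 (G y); lra.
Qed.

End Bounds.

Section DirectSum.
Variables (R : realType) (X : normedModType R[i]) (k : nat).

Lemma nrm_dsum (x : dsum X k) : nrm x = \sum_i nrm (x i).
Proof.
apply: complexI; rewrite -nrmE rmorph_sum /=.
by apply: eq_bigr => i _; rewrite nrmE.
Qed.

Lemma nrm_dsum_ge (x : dsum X k) i : nrm (x i) <= nrm x.
Proof.
rewrite nrm_dsum (bigD1 i)//= lerDl; apply: sumr_ge0 => j _; exact: nrm_ge0.
Qed.

Lemma dsum_nrm_complete : nrm_complete X -> nrm_complete (dsum X k).
Proof.
move=> cX u uC.
have uiC i : exists l, forall e : R, 0 < e -> exists N, forall n, (N <= n)%N ->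
    nrm (u n i - l) < e.
  apply: cX => e /uC[N uN]; exists N => m n Nm Nn.
  apply: le_lt_trans (uN m n Nm Nn).
  by have := nrm_dsum_ge (u m - u n) i; rewrite !ffunE.
have [l lP] := choice uiC; exists [ffun i => l i] => e e0.
have e'0 : 0 < e / k.+1%:R by rewrite divr_gt0.
have [N NP] := choice (fun i => lP i _ e'0).
exists (\max_i N i) => n /bigmax_leqP Nn; rewrite nrm_dsum.
apply: (@le_lt_trans _ _ (\sum_(i < k) (e / k.+1%:R))).
  by apply: ler_sum => i _; rewrite !ffunE ltW// NP// Nn.
rewrite sumr_const card_ord -[X in X < _]mulr_natr -mulrA gtr_pMr//.
by rewrite mulrC ltr_pdivrMr// mul1r ltr_nat.
Qed.

End DirectSum.

(** * Dimensions, and the index of an operator invertible up to finite rank *)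

Section Dimension.
Variables (K : fieldType) (V : lmodType K).

Definition subspace (D : set V) : Prop :=
  D 0 /\ forall a x y, D x -> D y -> D (a *: x + y).

Lemma subspace_sum (D : set V) (I : Type) (r : seq I) (c : I -> K) (x : I -> V) :
  subspace D -> (forall i, D (x i)) -> D (\sum_(i <- r) c i *: x i).
Proof.
move=> [D0 DL] Dx; elim/big_rec: _ => // i y _ Dy; exact: DL.
Qed.

Lemma subspace0 : subspace [set (0 : V)].
Proof. by split=> // a x y /= -> ->; rewrite scaler0 addr0. Qed.

Definition free_mod (D : set V) n (e : 'I_n -> V) : Prop :=
  forall c : 'I_n -> K, D (\sum_i c i *: e i) -> forall i, c i = 0.

(** Expressing the e i by the f j gives an s x r matrix of coefficients; if r < s,
   its left kernel contains a nonzero relation between the e i modulo D. *)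
Lemma free_mod_le_span (D : set V) s r (e : 'I_s -> V) (f : 'I_r -> V) :
  subspace D -> free_mod D e ->
  (forall i, exists c : 'I_r -> K, D (e i - \sum_j c j *: f j)) -> (s <= r)%N.
Proof.
move=> sD fe /choice[C CP]; rewrite leqNgt; apply/negP => rs.
pose A := \matrix_(i < s, j < r) C i j.
have kA : kermx A != 0.
  rewrite -mxrank_eq0 mxrank_ker subn_eq0 -ltnNge.
  exact: leq_ltn_trans (rank_leq_col _) rs.
pose v := nz_row (kermx A).
have v0 : v != 0 by rewrite nz_row_eq0.
have vA : v *m A = 0 by apply/sub_kermxP; rewrite nz_row_sub.
move/eqP: v0; apply; apply/rowP => i; rewrite mxE; move: i.
apply: fe; have -> : \sum_i v 0 i *: e i =
    \sum_i v 0 i *: (e i - \sum_j C i j *: f j).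
  have vE : \sum_i v 0 i *: (e i - \sum_j C i j *: f j) =
     \sum_i v 0 i *: e i - \sum_j (v *m A) 0 j *: f j.
    rewrite (eq_bigr (fun i => v 0 i *: e i - \sum_j (v 0 i * C i j) *: f j)).
      rewrite big_split /= sumrN; congr (_ - _); rewrite exchange_big /=.
      apply: eq_bigr => j _; rewrite mxE scaler_suml.
      by apply: eq_bigr => i _; rewrite mxE.
    move=> i _; rewrite scalerBr scaler_sumr; congr (_ - _).
    by apply: eq_bigr => j _; rewrite scalerA.
  by rewrite vE vA [X in _ - X]big1 ?subr0// => j _; rewrite mxE scale0r.
exact: subspace_sum.
Qed.

Lemma has_dim_mod_uniq (E D : set V) m n :
  subspace D -> has_dim_mod E D m -> has_dim_mod E D n -> m = n.
Proof.
move=> sD [e [eE ef es]] [f [fE ff fs]]; apply/eqP; rewrite eqn_leq.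
apply/andP; split.
  by apply: (free_mod_le_span sD ef) => i; apply: fs.
by apply: (free_mod_le_span sD ff) => i; apply: es.
Qed.

(** A free family of maximal size in E spans E; its size is at most r. *)
Lemma has_dim_of_span (E : set V) r (x : 'I_r -> V) : subspace E ->
  (forall v, E v -> exists c : 'I_r -> K, v = \sum_i c i *: x i) ->
  exists2 s : nat, (s <= r)%N & has_dim E s.
Proof.
move=> sE Ex.
pose P s := `[< exists e : 'I_s -> V, (forall i, E (e i)) /\ free_mod [set 0] e >].
have P0 : exists s, P s.
  exists 0%N; apply/asboolP; exists (fun=> 0); split=> [[]//|c _ []//].
have Pr s : P s -> (s <= r)%N.
  move=> /asboolP[e [eE fe]]; have := @free_mod_le_span _ s r e x (@subspace0) fe; apply=> i.
  by have [c cE] := Ex _ (eE i); exists c => /=; rewrite cE subrr.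
have [s /asboolP[e [eE fe]] smax] := ex_maxnP P0 Pr.
exists s; first by apply: Pr; apply/asboolP; exists e.
exists e; split => // v Ev; apply: contrapT => nv.
suff : (s.+1 <= s)%N by rewrite ltnn.
apply/smax/asboolP.
exists (fun i => oapp e v (unlift ord0 i)); split.
  by move=> i; case: (unlift ord0 i) => //= j; apply: eE.
move=> c; rewrite /= big_ord_recl unlift_none /=.
rewrite (eq_bigr (fun i => c (lift ord0 i) *: e i)); last first.
  by move=> i _; rewrite liftK.
have [c0|c0] := eqVneq (c ord0) 0.
  rewrite c0 scale0r add0r => /fe ce i.
  by case: (unliftP ord0 i) => [j ->|-> //]; apply: ce.
move=> /eqP; rewrite addr_eq0 => /eqP cv; case: nv.
exists (fun i => - (c ord0)^-1 * c (lift ord0 i)); apply/eqP.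
rewrite subr_eq0; apply/eqP; transitivity ((c ord0)^-1 *: (c ord0 *: v)).
  by rewrite scalerA mulVf// scale1r.
rewrite cv scalerN scaler_sumr -sumrN; apply: eq_bigr => i _.
by rewrite scalerA mulNr scaleNr.
Qed.

End Dimension.

Lemma range_subspace (K : fieldType) (V W : lmodType K) (T : V -> W) :
  linear T -> subspace (range T).
Proof.
move=> lT; split; first by exists 0 => //; apply: lin0.
by move=> a _ _ [x _ <-] [y _ <-]; exists (a *: x + y) => //; rewrite lT.
Qed.

Lemma has_index_uniq (K : fieldType) (V W : lmodType K) (T : V -> W) z z' :
  linear T -> has_index T z -> has_index T z' -> z = z'.
Proof.
move=> lT [m [n [km cn ->]]] [m' [n' [km' cn' ->]]].
rewrite (has_dim_mod_uniq (@subspace0 K V) km km').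
by rewrite (has_dim_mod_uniq (range_subspace lT) cn cn').
Qed.

Lemma fredholm_indexE (K : fieldType) (V W : lmodType K) (T : V -> W) z :
  linear T -> has_index T z -> fredholm_index T = z.
Proof.
move=> lT Tz; rewrite /fredholm_index; case: xgetP => [y _|/(_ z)//].
by move=> /has_index_uniq; apply.
Qed.

(** T maps the range of 1 - ST into the range of 1 - TS, and S maps it back. With a
   and b the matrices of T and S between these two spaces, the kernel and the
   cokernel of T are those of a, so that the index is m - n by the rank theorem,
   and the traces of 1 - ST and 1 - TS are m - tr(ab) and n - tr(ba). *)
Lemma has_index_finite_rank (K : fieldType) (V W : lmodType K)
    (T : V -> W) (S : W -> V) m n (e : 'I_m -> V) (f : 'I_n -> W)
    (psi : 'I_m -> V -> K) (chi : 'I_n -> W -> K) :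
  linear T -> linear S ->
  free_mod [set 0] e -> free_mod [set 0] f ->
  (forall i, exists v, e i = v - S (T v)) ->
  (forall j, exists w, f j = w - T (S w)) ->
  (forall v, v - S (T v) = \sum_i psi i v *: e i) ->
  (forall w, w - T (S w) = \sum_j chi j w *: f j) ->
  has_index T (m%:Z - n%:Z) /\
  \sum_i psi i (e i) - \sum_j chi j (f j) = m%:R - n%:R.
Proof.
move=> lT lS fe ff eR fR psiE chiE.
have [a aE] : exists a : 'M[K]_(m, n), forall i, T (e i) = \sum_j a i j *: f j.
  have /choice[a aE] : forall i, exists c : 'I_n -> K, T (e i) = \sum_j c j *: f j.
    move=> i; have [v ->] := eR i; exists (fun j => chi j (T v)).
    by rewrite -chiE (linB lT).
  exists (\matrix_(i, j) a i j) => i; rewrite aE.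
  by apply: eq_bigr => j _; rewrite mxE.
have [b bE] : exists b : 'M[K]_(n, m), forall j, S (f j) = \sum_i b j i *: e i.
  have /choice[b bE] : forall j, exists c : 'I_m -> K, S (f j) = \sum_i c i *: e i.
    move=> j; have [w ->] := fR j; exists (fun i => psi i (S w)).
    by rewrite -psiE (linB lS).
  exists (\matrix_(i, j) b i j) => i; rewrite bE.
  by apply: eq_bigr => j _; rewrite mxE.
have Tsum (c : 'I_m -> K) :
    T (\sum_i c i *: e i) = \sum_j ((\row_i c i) *m a) 0 j *: f j.
  rewrite (lin_sum lT) (eq_bigr (fun i => \sum_j (c i * a i j) *: f j)).
    rewrite exchange_big /=; apply: eq_bigr => j _; rewrite mxE scaler_suml.
    by apply: eq_bigr => i _; rewrite mxE.
  move=> i _; rewrite (linZ lT) aE scaler_sumr.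
  by apply: eq_bigr => j _; rewrite scalerA.
have Ssum (c : 'I_n -> K) :
    S (\sum_j c j *: f j) = \sum_i ((\row_j c j) *m b) 0 i *: e i.
  rewrite (lin_sum lS) (eq_bigr (fun j => \sum_i (c j * b j i) *: e i)).
    rewrite exchange_big /=; apply: eq_bigr => i _; rewrite mxE scaler_suml.
    by apply: eq_bigr => j _; rewrite mxE.
  move=> i _; rewrite (linZ lS) bE scaler_sumr.
  by apply: eq_bigr => j _; rewrite scalerA.
have free_eq k (U : lmodType K) (g : 'I_k -> U) (c d : 'I_k -> K) :
    free_mod [set 0] g -> \sum_i c i *: g i = \sum_i d i *: g i -> c =1 d.
  move=> fg cd i; apply/eqP; rewrite -subr_eq0; apply/eqP.
  apply: (fg (fun i => c i - d i)) => /=.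
  under eq_bigr do rewrite scalerBl.
  by rewrite sumrB cd subrr.
have psi_e i j : psi j (e i) = (i == j)%:R - (a *m b) i j.
  move: j; apply: (free_eq _ _ e) => //; rewrite -psiE aE Ssum.
  rewrite [X in _ - X](eq_bigr (fun j => (a *m b) i j *: e j)); last first.
    move=> j _; congr (_ *: _); rewrite !mxE; apply: eq_bigr => l _.
    by rewrite !mxE.
  under [RHS]eq_bigr do rewrite scalerBl.
  rewrite sumrB; congr (_ - _); rewrite (bigD1 i)//= eqxx scale1r big1 ?addr0//.
  by move=> j; rewrite eq_sym => /negPf ->; rewrite scale0r.
have chi_f i j : chi j (f i) = (i == j)%:R - (b *m a) i j.
  move: j; apply: (free_eq _ _ f) => //; rewrite -chiE bE Tsum.
  rewrite [X in _ - X](eq_bigr (fun j => (b *m a) i j *: f j)); last first.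
    move=> j _; congr (_ *: _); rewrite !mxE; apply: eq_bigr => l _.
    by rewrite !mxE.
  under [RHS]eq_bigr do rewrite scalerBl.
  rewrite sumrB; congr (_ - _); rewrite (bigD1 i)//= eqxx scale1r big1 ?addr0//.
  by move=> j; rewrite eq_sym => /negPf ->; rewrite scale0r.
split; last first.
  rewrite (eq_bigr (fun i => 1 - (a *m b) i i)) => [|i _]; last first.
    by rewrite psi_e eqxx.
  rewrite [X in _ - X](eq_bigr (fun i => 1 - (b *m a) i i)) => [|i _]; last first.
    by rewrite chi_f eqxx.
  rewrite !sumrB -/(\tr (a *m b)) -/(\tr (b *m a)) mxtrace_mulC.
  by rewrite opprB addrA subrK !sumr_const !card_ord.
have row_sum k (c : 'rV[K]_k) p (A : 'M[K]_(k, p)) (U : lmodType K) (g : 'I_p -> U) :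
    \sum_i c 0 i *: (\sum_j A i j *: g j) = \sum_j (c *m A) 0 j *: g j.
  rewrite (eq_bigr (fun i => \sum_j (c 0 i * A i j) *: g j)).
    rewrite exchange_big /=; apply: eq_bigr => j _.
    by rewrite mxE scaler_suml.
  by move=> i _; rewrite scaler_sumr; apply: eq_bigr => j _; rewrite scalerA.
exists (\rank (kermx a)), (\rank (a^C)%MS); split; last first.
- rewrite mxrank_ker mxrank_compl.
  have := rank_leq_row a; have := rank_leq_col a.
  by move=> h1 h2; rewrite -!subzn//; ring.
  (* A complement of the row space of a represents the cokernel. *)
- pose w := row_base (a^C)%MS.
  exists (fun k => \sum_j w k j *: f j); split => //.
    move=> c [v _ Tv].
    pose cr : 'rV[K]_(\rank (a^C)%MS) := \row_i c i.
    have cE : \sum_i c i *: (\sum_j w i j *: f j) = \sum_j (cr *m w) 0 j *: f j.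
      by rewrite -row_sum; apply: eq_bigr => i _; rewrite mxE.
    have vE : v = \sum_i (psi i v + ((cr *m w) *m b) 0 i) *: e i.
      under eq_bigr do rewrite scalerDl.
      rewrite big_split /= -psiE Tv cE Ssum.
      rewrite (eq_bigr (fun i => ((cr *m w) *m b) 0 i *: e i)) ?subrK//.
      move=> i _; congr ((_ *m b) 0 i *: _).
      by apply/rowP => j; rewrite mxE.
    have cw : cr *m w = (\row_i (psi i v + ((cr *m w) *m b) 0 i)) *m a.
      apply/rowP; apply: (free_eq _ _ f) => //.
      by rewrite -cE -Tv {1}vE Tsum.
    have : (cr *m w <= a :&: a^C)%MS.
      rewrite sub_capmx {1}cw submxMl /=.
      by rewrite (submx_trans (submxMl _ _))// eq_row_base.
    rewrite capmx_compl submx0 => /eqP cw0 i.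
    have /rowP/(_ i) : cr = 0.
      by apply: (row_free_inj (row_base_free _)); rewrite -/w mul0mx.
    by rewrite !mxE.
  move=> y _.
  pose h := \row_j chi j y.
  have : (h <= a + row_base (a^C)%MS)%MS.
    have h1 : (h <= a + a^C)%MS by rewrite submx_full// addsmx_compl_full.
    by apply: submx_trans h1 _; rewrite addsmxS ?eq_row_base.
  move=> /sub_addsmxP[[g d] /= hE]; exists (fun k => d 0 k).
  exists (S y + \sum_i g 0 i *: e i) => //.
  rewrite (linD lT) Tsum.
  have -> : (\row_i g 0 i) *m a = g *m a by congr (_ *m _); apply/rowP => i; rewrite mxE.
  rewrite row_sum -/w.
  have yE : y = T (S y) + \sum_j h 0 j *: f j.
    under eq_bigr do rewrite mxE.
    by rewrite -chiE addrC subrK.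
  rewrite {2}yE hE; under [in RHS]eq_bigr do rewrite mxE scalerDl.
  by rewrite big_split /= addrA addrK.
- pose w := row_base (kermx a).
  exists (fun k => \sum_j w k j *: e j); split.
  + move=> k /=; rewrite Tsum big1// => j _.
    suff -> : (\row_i w k i) *m a = 0 by rewrite mxE scale0r.
    have -> : \row_i w k i = row k w by apply/rowP => i; rewrite !mxE.
    by apply/sub_kermxP; rewrite (submx_trans (row_sub _ _))// eq_row_base.
  + move=> c /=.
    pose cr : 'rV[K]_(\rank (kermx a)) := \row_i c i.
    have -> : \sum_i c i *: (\sum_j w i j *: e j) = \sum_j (cr *m w) 0 j *: e j.
      by rewrite -row_sum; apply: eq_bigr => i _; rewrite mxE.
    move=> /fe cw i.
    have /rowP/(_ i) : cr = 0.
      apply: (row_free_inj (row_base_free _)); rewrite -/w mul0mx.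
      by apply/rowP => j; rewrite cw mxE.
    by rewrite !mxE.
  + move=> v /= Tv0.
    have vE : v = \sum_i psi i v *: e i by rewrite -psiE Tv0 (lin0 lS) subr0.
    have : (\row_i psi i v <= row_base (kermx a))%MS.
      rewrite eq_row_base; apply/sub_kermxP/rowP; apply: (free_eq _ _ f) => //.
      rewrite -Tsum -vE Tv0 big1// => j _; by rewrite mxE scale0r.
    move=> /submxP[d dE]; exists (fun k => d 0 k).
    rewrite row_sum -/w in dE *; rewrite -dE {1}vE; apply/eqP.
    rewrite subr_eq0; apply/eqP/eq_bigr => i _; by rewrite mxE.
Qed.

(** * Finite-rank operators and their trace *)

Section Coordinates.
Variables (R : realType) (X : normedModType R[i]).

Lemma eps_inv (e : R) : 0 < e -> exists N, forall n, (N <= n)%N -> n.+1%:R^-1 < e.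
Proof.
move=> e0; have [N NP] : exists N, e^-1 < N%:R.
  by exists (Num.truncn e^-1).+1; rewrite truncnS_gt.
exists N => n Nn; rewrite -[e]invrK ltf_pV2 ?posrE ?invr_gt0//.
by rewrite (lt_le_trans NP)// ler_nat ltnW.
Qed.

(** All norms on a finite-dimensional space are equivalent; in the induction, the
   completeness of the complex numbers shows that the first vector has a positive
   distance to the span of the others. *)
Lemma free_coord_bound r (e : 'I_r -> X) : free_mod [set 0] e ->
  exists2 C : R, 0 <= C &
    forall c i, cabs (c i) <= C * nrm (\sum_j c j *: e j).
Proof.
elim: r e => [|r IH] e fe; first by exists 0 => // c [].
pose e' i := e (lift ord0 i).
have fe' : free_mod [set 0] e'.
  move=> c /= ce0 i.
  have := fe (fun j => oapp c 0 (unlift ord0 j)); rewrite /= big_ord_recl.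
  rewrite unlift_none /= scale0r add0r.
  rewrite (eq_bigr (fun i => c i *: e' i)) => [/(_ ce0 (lift ord0 i))|j _].
    by rewrite liftK.
  by rewrite liftK.
have [C C0 CP] := IH _ fe'.
have [d d0 dP] : exists2 d : R, 0 < d &
    forall c : 'I_r -> R[i], d <= nrm (e ord0 + \sum_i c i *: e' i).
  apply: contrapT => nd.
  have /choice[c cP] : forall n, exists c : 'I_r -> R[i],
      nrm (e ord0 + \sum_i c i *: e' i) < n.+1%:R^-1.
    move=> n; apply: contrapT => nc; apply: nd; exists n.+1%:R^-1 => // c.
    by rewrite leNgt; apply/negP => h; apply: nc; exists c.
  have /choice[l lP] : forall i, exists l : R[i], forall t : R, 0 < t ->
      exists N, forall n, (N <= n)%N -> cabs (c n i - l) < t.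
    move=> i; apply: (@complex_nrm_complete R (fun n => c n i)) => t t0.
    have t'0 : 0 < t / (2 * (C + 1)) by rewrite divr_gt0// mulr_gt0// ltr_wpDl.
    have [N NP] := eps_inv t'0; exists N => m n Nm Nn.
    have := CP (fun i => c m i - c n i) i.
    under eq_bigr do rewrite scalerBl.
    rewrite sumrB => /le_lt_trans; apply.
    have -> : \sum_i c m i *: e' i - \sum_i c n i *: e' i =
        (e ord0 + \sum_i c m i *: e' i) - (e ord0 + \sum_i c n i *: e' i).
      by rewrite opprD addrACA subrr add0r.
    apply: (@le_lt_trans _ _ (C * (t / (2 * (C + 1)) + t / (2 * (C + 1))))).
      apply: ler_wpM2l => //; apply: le_trans (nrmB _ _) _.
      by apply: lerD; apply: ltW; apply: lt_trans (cP _) _; apply: NP.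
    have C1 : 0 < C + 1 by rewrite ltr_wpDl.
    have -> : C * (t / (2 * (C + 1)) + t / (2 * (C + 1))) = t * (C / (C + 1)).
      by field; rewrite gt_eqF.
    by rewrite gtr_pMr// ltr_pdivrMr// mul1r ltrDl.
  have e0 : e ord0 + \sum_i l i *: e' i = 0.
    apply/nrm_eq0/eqP; rewrite eq_le nrm_ge0 andbT.
    apply/ler_addgt0Pl => t t0; rewrite addr0.
    pose s := \sum_i nrm (e' i).
    have s0 : 0 <= s by apply: sumr_ge0 => i _; apply: nrm_ge0.
    have t20 : 0 < t / 2 by rewrite divr_gt0.
    have ts0 : 0 < t / 2 / (s + 1) by rewrite divr_gt0// ltr_wpDl.
    have [N NP] := eps_inv t20.
    have /choice[N' N'P] := fun i => lP i _ ts0.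
    pose n := maxn N (\max_i N' i).
    have -> : e ord0 + \sum_i l i *: e' i =
        (e ord0 + \sum_i c n i *: e' i) - \sum_i (c n i - l i) *: e' i.
      under [X in _ = _ - X]eq_bigr do rewrite scalerBl.
      by rewrite sumrB opprB -[RHS]addrA [X in _ = _ + X]addrC subrK.
    apply: le_trans (nrmB _ _) _; rewrite (splitr t); apply: lerD.
      by apply: ltW; apply: lt_trans (cP _) _; apply: NP; rewrite leq_maxl.
    apply: le_trans (nrm_sum _ _ _) _.
    apply: (@le_trans _ _ (\sum_i t / 2 / (s + 1) * nrm (e' i))).
      apply: ler_sum => i _; rewrite nrmZ ler_wpM2r ?nrm_ge0// ltW// N'P//.
      by rewrite leq_max; apply/orP; right; apply: leq_bigmax.
    rewrite -mulr_sumr -/s -mulrA ler_piMr ?(ltW t20)//.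
    by rewrite mulrC ler_pdivrMr ?mul1r ?lerDl// ltr_wpDl.
  have := fe (fun j => oapp l 1 (unlift ord0 j)); rewrite /= big_ord_recl.
  rewrite unlift_none /= scale1r (eq_bigr (fun i => l i *: e' i)); last first.
    by move=> i _; rewrite liftK.
  move=> /(_ e0 ord0); rewrite unlift_none /= => /eqP; by rewrite oner_eq0.
have c0P (c : 'I_r.+1 -> R[i]) : cabs (c ord0) <= d^-1 * nrm (\sum_j c j *: e j).
  have [->|c0] := eqVneq (c ord0) 0.
    by rewrite cabs0 mulr_ge0 ?nrm_ge0// invr_ge0 ltW.
  rewrite mulrC ler_pdivlMr//.
  have -> : \sum_j c j *: e j =
      c ord0 *: (e ord0 + \sum_i ((c ord0)^-1 * c (lift ord0 i)) *: e' i).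
    rewrite big_ord_recl scalerDr scaler_sumr; congr (_ + _).
    by apply: eq_bigr => i _; rewrite scalerA mulVKf.
  by rewrite nrmZ ler_wpM2l ?cabs_ge0.
pose C' := C * (1 + d^-1 * nrm (e ord0)).
have C'0 : 0 <= C'.
  by rewrite mulr_ge0// addr_ge0// mulr_ge0 ?nrm_ge0// invr_ge0 ltW.
exists (Num.max d^-1 C'); first by rewrite le_max C'0 orbT.
move=> c i; have [j ->|->] := unliftP ord0 i; last first.
  apply: le_trans (c0P c) _.
  by rewrite ler_wpM2r ?nrm_ge0// le_max lexx.
apply: (@le_trans _ _ (C' * nrm (\sum_j c j *: e j))); last first.
  by rewrite ler_wpM2r ?nrm_ge0// le_max lexx orbT.
apply: le_trans (CP (fun j => c (lift ord0 j)) j) _.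
rewrite -mulrA ler_wpM2l// mulrDl mul1r.
have -> : \sum_i c (lift ord0 i) *: e' i = \sum_i c i *: e i - c ord0 *: e ord0.
  by rewrite big_ord_recl addrC addKr.
apply: le_trans (nrmB _ _) _; rewrite lerD2l nrmZ mulrAC ler_wpM2r ?nrm_ge0//.
Qed.

End Coordinates.

Section FiniteRank.
Variable R : realType.

(** Rank at most k, in a form which gives sums, composites and the trace without
   any choice of bases. *)
Definition frk (X Y : normedModType R[i]) (k : nat) (T : X -> Y) : Prop :=
  exists (phi : 'I_k -> X -> R[i]^o) (x : 'I_k -> Y),
    (forall i, bounded_op (phi i)) /\ forall y, T y = \sum_i phi i y *: x i.

Implicit Types X Y Z : normedModType R[i].

Lemma frk_coords X Y (T : X -> Y) r (e : 'I_r -> Y) :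
  bounded_op T -> free_mod [set 0] e ->
  (forall y, exists c : 'I_r -> R[i], T y = \sum_i c i *: e i) ->
  exists phi : 'I_r -> X -> R[i]^o, (forall i, bounded_op (phi i)) /\
     forall y, T y = \sum_i phi i y *: e i.
Proof.
move=> /bounded_opP[lT [M M0 TM]] fe /choice[phi phiE].
exists (fun i y => phi y i); split => // i.
have [C C0 CP] := free_coord_bound fe.
apply/bounded_opP; split.
  move=> a x y; apply/eqP; rewrite -subr_eq0; apply/eqP.
  apply: (fe (fun i => phi (a *: x + y) i - (a *: (phi x i : R[i]^o) + phi y i))) => /=.
  under eq_bigr do rewrite scalerBl scalerDl -scalerA.
  by rewrite sumrB big_split /= -scaler_sumr -!phiE lT subrr.
exists (C * M); first exact: mulr_ge0.
move=> y; apply: le_trans (CP _ _) _; rewrite -phiE -mulrA.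
exact: ler_wpM2l.
Qed.

Lemma frk_bounded X Y k (T : X -> Y) : frk k T -> bounded_op T.
Proof.
move=> [phi [x [phib TE]]].
have -> : T = \sum_i (fun y => phi i y *: x i).
  by apply/funext => y; rewrite TE fct_sumE.
elim/big_ind: _ => [|S S' bS bS'|i _]; [exact: bounded0|exact: boundedD|].
have /bounded_opP[lp [M M0 pM]] := phib i; apply/bounded_opP; split.
  by move=> a u v; rewrite lp scalerDl scalerA.
exists (M * nrm (x i)); first by rewrite mulr_ge0 ?nrm_ge0.
by move=> y; rewrite nrmZ mulrAC ler_wpM2r ?nrm_ge0//; apply: pM.
Qed.

(** The coordinates on the range of a bounded operator are bounded, by the
   equivalence of norms on a finite-dimensional space. *)
Lemma frkP X Y k (T : X -> Y) : frk k T <-> bounded_op T /\ rank_lt T k.+1.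
Proof.
split=> [fT|[bT [r rk [e [eE fe es]]]]].
  split; first exact: frk_bounded fT.
  have [lT _] := frk_bounded fT.
  have [phi [x [_ TE]]] := fT.
  have [s sk Ts] : exists2 s, (s <= k)%N & has_dim (range T) s.
    apply: (@has_dim_of_span _ _ _ _ x (range_subspace lT)) => _ [y _ <-].
    by exists (fun i => phi i y); rewrite TE.
  by exists s.
have [|phi [phib TE]] := frk_coords bT fe.
  move=> y; have [|c /= /eqP] := es (T y); first by exists y.
  by rewrite subr_eq0 => /eqP ->; exists c.
exists (fun i => if insub (i : nat) is Some j then phi j else 0).
exists (fun i => if insub (i : nat) is Some j then e j else 0); split.
  by move=> i; case: insubP => [j _ _|_]; [exact: phib|exact: bounded0].
move=> y; rewrite TE.
rewrite (eq_bigr (fun i : 'I_k => (fun n : nat => if insub n is Some j then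
   (phi : 'I_r -> _) j y *: e j else 0) (i : nat))); last first.
  by move=> i _; case: insubP => // _; rewrite scaler0.
rewrite -(@big_mkord _ 0 _ k xpredT (fun n : nat => if insub n is Some j then
   (phi : 'I_r -> _) j y *: e j else 0)).
rewrite (big_cat_nat (n := r))//= [X in _ + X]big_nat_cond [X in _ + X]big1 ?addr0; last first.
  by move=> i; rewrite andbT => /andP[ri _]; rewrite insubF// ltnNge ri.
by rewrite big_mkord; apply: eq_bigr => i _; rewrite valK.
Qed.

Lemma frk0 X Y : frk 0 (0 : X -> Y).
Proof. by exists (fun=> 0), (fun=> 0); split=> [[]//|y]; rewrite big_ord0. Qed.

Lemma frk_le X Y k l (T : X -> Y) : (k <= l)%N -> frk k T -> frk l T.
Proof.
move=> kl /frkP[bT [r rk dr]]; apply/frkP; split => //.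
by exists r => //; apply: leq_trans rk _.
Qed.

Lemma frkD X Y k l (S T : X -> Y) : frk k S -> frk l T -> frk (k + l) (S + T).
Proof.
move=> [phi [x [phib SE]]] [psi [y [psib TE]]].
exists (fun i : 'I_(k + l) => match fintype.split i with inl a => phi a | inr b => psi b end).
exists (fun i : 'I_(k + l) => match fintype.split i with inl a => x a | inr b => y b end); split.
  by move=> i; case: (fintype.split i).
move=> v; rewrite !fctE SE TE big_split_ord /=; congr (_ + _).
  by apply: eq_bigr => i _; rewrite (unsplitK (inl i)).
by apply: eq_bigr => i _; rewrite (unsplitK (inr i)).
Qed.

Lemma frkN X Y k (T : X -> Y) : frk k T -> frk k (- T).
Proof.
move=> [phi [x [phib TE]]]; exists phi, (fun i => - x i); split => // v.
by rewrite !fctE TE -sumrN; apply: eq_bigr => i _; rewrite scalerN.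
Qed.

Lemma frkB X Y k l (S T : X -> Y) : frk k S -> frk l T -> frk (k + l) (S - T).
Proof. by move=> fS fT; apply: frkD => //; apply: frkN. Qed.

Lemma frk_compl X Y Z k (S : Y -> Z) (T : X -> Y) :
  linear S -> frk k T -> frk k (S \o T).
Proof.
move=> lS [phi [x [phib TE]]]; exists phi, (fun i => S (x i)); split => // v.
rewrite /= TE (lin_sum lS); by apply: eq_bigr => i _; rewrite (linZ lS).
Qed.

Lemma frk_compr X Y Z k (S : Y -> Z) (T : X -> Y) :
  bounded_op T -> frk k S -> frk k (S \o T).
Proof.
move=> bT [phi [x [phib SE]]]; exists (fun i => phi i \o T), x; split.
  by move=> i; apply: bounded_comp.
by move=> v; rewrite /= SE.
Qed.

Lemma frk_trace X k (T : X -> X) : frk k T -> exists t, has_finite_trace T t.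
Proof.
by move=> [phi [x [phib TE]]]; exists (\sum_i phi i (x i)), k, phi, x.
Qed.

Lemma has_finite_trace_frk X (T : X -> X) t :
  has_finite_trace T t -> exists k, frk k T.
Proof. by move=> [k [phi [x [phib TE _]]]]; exists k, phi, x. Qed.

End FiniteRank.

Section TraceBound.
Variable R : realType.
Implicit Types X : normedModType R[i].

(** The trace is the sum of the eigenvalues of the matrix phi_j(x_i), and a
   nonzero eigenvalue of this matrix is an eigenvalue of T, hence at most the
   norm of T. *)
Lemma trace_bound X k (phi : 'I_k -> X -> R[i]) (x : 'I_k -> X) (T : X -> X) M :
  (forall i a u v, phi i (a *: u + v) = a * phi i u + phi i v) ->
  (forall y, T y = \sum_i phi i y *: x i) -> 0 <= M -> opb T M ->
  cabs (\sum_i phi i (x i)) <= k%:R * M.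
Proof.
move=> lphi TE M0 TM.
case: k phi x lphi TE => [|k] phi x lphi TE.
  by rewrite big_ord0 cabs0 mul0r.
pose A := \matrix_(i < k.+1, j < k.+1) phi j (x i).
have lphi' i : linear (phi i : X -> R[i]^o) by move=> a u v; rewrite lphi.
have trA : \sum_i phi i (x i) = \tr A by apply: eq_bigr => i _; rewrite mxE.
have [r rE] := closed_field_poly_normal (char_poly A).
have chM : lead_coef (char_poly A) = 1 by apply/monicP/char_poly_monic.
rewrite chM scale1r in rE.
have sr : size r = k.+1.
  have := size_char_poly A; rewrite rE.
  by rewrite (size_prod_XsubC r id) => -[].
have -> : \sum_i phi i (x i) = \sum_(z <- r) z.
  apply: oppr_inj; rewrite trA -char_poly_trace// rE -coefPn_prod_XsubC ?sr//.
have root_bound z : z \in r -> cabs z <= M.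
  move=> zr; have : root (char_poly A) z by rewrite rE root_prod_XsubC.
  rewrite -eigenvalue_root_char => /eigenvalueP[v vA v0].
  pose w := \sum_i v 0 i *: x i.
  have phiw j : phi j w = z * v 0 j.
    rewrite /w (lin_sum (lphi' j)).
    move/rowP : vA => /(_ j); rewrite !mxE => <-.
    by apply: eq_bigr => i _; rewrite (linZ (lphi' j)) mxE.
  have Tw : T w = z *: w.
    rewrite TE scaler_sumr; apply: eq_bigr => i _.
    by rewrite phiw scalerA.
  have [w0|w0] := eqVneq w 0.
    suff -> : z = 0 by rewrite cabs0.
    apply/eqP; apply: contraNT v0 => z0; apply/eqP/rowP => j; rewrite mxE.
    have := phiw j; rewrite w0 (lin0 (lphi' j)) => /esym/eqP.
    by rewrite mulf_eq0 (negPf z0) /= => /eqP.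
  have := TM w; rewrite Tw nrmZ ler_pM2r//; exact: nrm_gt0.
apply: le_trans (cabs_sum _ _ _) _.
apply: (@le_trans _ _ (\sum_(z <- r) M)).
  by rewrite big_seq [leRHS]big_seq; apply: ler_sum => z zr; apply: root_bound.
by rewrite big_const_seq count_predT sr iter_addr_0 mulr_natl.
Qed.

(** As [has_finite_trace], but remembering the number of terms, for the estimates,
   and with functionals that are only linear. *)
Definition rank_trace X (k : nat) (T : X -> X) (t : R[i]) : Prop :=
  exists (phi : 'I_k -> X -> R[i]^o) (x : 'I_k -> X),
    [/\ forall i, linear (phi i), forall y, T y = \sum_i phi i y *: x i &
        t = \sum_i phi i (x i)].

Lemma has_finite_rank_trace X (T : X -> X) t :
  has_finite_trace T t -> exists k, rank_trace k T t.
Proof.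
move=> [k [phi [x [phib TE tE]]]]; exists k, phi, x; split => // i.
by have [] := phib i.
Qed.

Lemma rank_traceB X k k' (T T' : X -> X) t t' :
  rank_trace k T t -> rank_trace k' T' t' ->
  rank_trace (k + k') (T - T') (t - t').
Proof.
move=> [phi [x [phil TE ->]]] [psi [y [psil TE' ->]]].
pose chi (i : 'I_(k + k')) := match fintype.split i with inl a => phi a | inr b => psi b end.
pose z (i : 'I_(k + k')) := match fintype.split i with inl a => x a | inr b => - y b end.
have chil i : chi (lshift k' i) = phi i by rewrite /chi (unsplitK (inl i)).
have chir i : chi (rshift k i) = psi i by rewrite /chi (unsplitK (inr i)).
have zl i : z (lshift k' i) = x i by rewrite /z (unsplitK (inl i)).
have zr i : z (rshift k i) = - y i by rewrite /z (unsplitK (inr i)).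
exists chi, z; split.
- by move=> i; rewrite /chi; case: (fintype.split i).
- move=> v; rewrite !fctE TE TE' big_split_ord /= -sumrN; congr (_ + _).
    by apply: eq_bigr => i _; rewrite chil zl.
  by apply: eq_bigr => i _; rewrite chir zr scalerN.
- rewrite big_split_ord /= -sumrN; congr (_ + _); apply: eq_bigr => i _.
    by rewrite chil zl.
  by rewrite chir zr (linN (psil i)).
Qed.

Lemma rank_trace_bound X k (T : X -> X) t M :
  rank_trace k T t -> 0 <= M -> opb T M -> cabs t <= k%:R * M.
Proof. by move=> [phi [x [phil TE ->]]]; apply: trace_bound. Qed.

(** The difference of two expressions of T is an expression of 0, whose norm is 0. *)
Lemma rank_trace_uniq X k k' (T : X -> X) t t' :
  rank_trace k T t -> rank_trace k' T t' -> t = t'.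
Proof.
move=> Tt Tt'; apply/eqP; rewrite -subr_eq0; apply/eqP/cabs_eq0/eqP.
rewrite eq_le cabs_ge0 andbT.
have := rank_trace_bound (rank_traceB Tt Tt') (lexx 0).
by rewrite mulr0 subrr => /(_ (@opb0 _ _ _)).
Qed.

Lemma frk_trace_comm X k (S T : X -> X) : frk k S -> bounded_op T ->
  exists t, has_finite_trace (S \o T) t /\ has_finite_trace (T \o S) t.
Proof.
move=> [phi [x [phib SE]]] bT; have [lT _] := bT.
exists (\sum_i phi i (T (x i))); split.
  exists k, (fun i => phi i \o T), x; split=> // [i|y]; first exact: bounded_comp.
  by rewrite /= SE.
exists k, phi, (fun i => T (x i)); split=> // y.
by rewrite /= SE (lin_sum lT); apply: eq_bigr => i _; rewrite (linZ lT).
Qed.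

End TraceBound.

(** * Approximation by finite-rank operators *)

Section Sequences.
Variable R : realType.
Implicit Types s t : nat -> R.

Definition noninc_ge0 s : Prop :=
  (forall k, 0 <= s k) /\ (forall i j, (i <= j)%N -> s j <= s i).

Definition sum_le s (B : R) : Prop := forall n, \sum_(k < n) s k <= B.

Lemma noninc_ge0D s t : noninc_ge0 s -> noninc_ge0 t ->
  noninc_ge0 (fun k => s k + t k).
Proof.
by move=> [s0 sm] [t0 tm]; split=> [k|i j ij]; [apply: addr_ge0|apply: lerD; auto].
Qed.

Lemma noninc_ge0M s t : noninc_ge0 s -> noninc_ge0 t ->
  noninc_ge0 (fun k => s k * t k).
Proof.
move=> [s0 sm] [t0 tm]; split=> [k|i j ij]; first exact: mulr_ge0.
by apply: ler_pM; auto.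
Qed.

Lemma sum_le_ge0 s B : sum_le s B -> 0 <= B.
Proof. by move=> /(_ 0%N); rewrite big_ord0. Qed.

Lemma sum_le_mono s n m : (forall k, 0 <= s k) -> (n <= m)%N ->
  \sum_(k < n) s k <= \sum_(k < m) s k.
Proof.
move=> s0 nm; rewrite -(subnKC nm) big_split_ord /= lerDl.
by apply: sumr_ge0.
Qed.

Lemma sum_le_tail s B e : (forall k, 0 <= s k) -> sum_le s B -> 0 < e ->
  exists N, forall n, \sum_(N <= k < n) s k <= e.
Proof.
move=> s0 sB e0.
pose S := [set x : R | exists n, x = \sum_(k < n) s k].
have hS : has_sup S.
  split; first by exists 0, 0%N; rewrite big_ord0.
  by exists B => _ [n ->].
have [_ [N ->] SN] := sup_adherent e0 hS.
exists N => n; have [Nn|nN] := leqP N n; last by rewrite (big_geq (ltnW nN)) ltW.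
have : \sum_(k < n) s k <= sup S by apply: ub_le_sup; [case: hS|exists n].
rewrite -(big_mkord xpredT s) (big_cat_nat (n := N))//= big_mkord.
by move: SN; lra.
Qed.

(** Each value of s is taken c times by k |-> s (k %/ c). *)
Lemma sum_divn s c n :
  \sum_(k < c * n) s (k %/ c)%N = c%:R * \sum_(k < n) s k.
Proof.
elim: n => [|n IH]; first by rewrite muln0 !big_ord0 mulr0.
rewrite mulnSr big_split_ord /= IH big_ord_recr /= mulrDr; congr (_ + _).
case: c {IH} => [|c]; first by rewrite big_ord0 mul0r.
rewrite (eq_bigr (fun=> s n)) => [|k _].
  by rewrite sumr_const card_ord mulr_natl.
by rewrite mulnC divnMDl// divn_small ?addn0.
Qed.

Lemma sum_le_divn s c B : (forall k, 0 <= s k) -> (0 < c)%N -> sum_le s B ->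
  sum_le (fun k => s (k %/ c)%N) (c%:R * B).
Proof.
move=> s0 c0 sB n.
apply: (@le_trans _ _ (\sum_(k < c * n) s (k %/ c)%N)).
  by apply: (@sum_le_mono (fun k => s (k %/ c)%N)) => //; rewrite leq_pmull.
by rewrite sum_divn ler_wpM2l.
Qed.

(** Cauchy condensation: the term of index 2 ^ J is at most each of the
   last 2 ^ (J - 1) terms up to it, which accounts for the factor 2. *)
Lemma sum_condensation s J : noninc_ge0 s ->
  \sum_(j < J.+1) 2 ^+ j * s (2 ^ j)%N <= 2 * \sum_(k < 2 ^ J) s k.+1.
Proof.
move=> [s0 sm]; elim: J => [|J IH].
  by rewrite expn0 !big_ord_recr !big_ord0 /= !add0r expr0 mul1r; have := s0 1%N; lra.
rewrite big_ord_recr /= expnS mul2n -addnn big_split_ord /= mulrDr; apply: lerD => //.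
rewrite exprS -mulrA ler_wpM2l//.
apply: (@le_trans _ _ (\sum_(k < 2 ^ J) s (2 ^ J + 2 ^ J)%N)).
  by rewrite sumr_const card_ord -[leRHS]mulr_natl natrX.
by apply: ler_sum => k _; apply: sm; rewrite -addnS leq_add2l.
Qed.

End Sequences.

Section Approximable.
Variable R : realType.
Implicit Types X Y Z : normedModType R[i].

(** T is within s_k of rank c * k; the factor c makes the notion stable under
   sums and composites without reindexing s. *)
Definition appr X Y (c : nat) (s : nat -> R) (T : X -> Y) : Prop :=
  [/\ linear T, noninc_ge0 s &
      forall k, exists2 Q : X -> Y, frk (c * k) Q & opb (T - Q) (s k)].

Lemma frk0P X Y (Q : X -> Y) : frk 0 Q -> Q = 0.
Proof.
by move=> [phi [x [_ QE]]]; apply/funext => y; rewrite QE big_ord0.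
Qed.

Lemma appr_opb X Y c s (T : X -> Y) : appr c s T -> opb T (s 0%N).
Proof.
move=> [_ _ /(_ 0%N)[Q]]; rewrite muln0 => /frk0P ->.
by rewrite subr0.
Qed.

Lemma appr_bounded X Y c s (T : X -> Y) : appr c s T -> bounded_op T.
Proof.
move=> aT; have TB := appr_opb aT; case: aT => lT [s0 _] _.
by apply/bounded_opP; split => //; exists (s 0%N).
Qed.

Lemma appr_le X Y c c' s s' (T : X -> Y) : (c <= c')%N ->
  (forall k, s k <= s' k) -> noninc_ge0 s' -> appr c s T -> appr c' s' T.
Proof.
move=> cc ss s'm [lT _ TQ]; split => // k; have [Q fQ TQk] := TQ k.
exists Q; last exact: opb_le (ss k) TQk.
by apply: frk_le fQ; rewrite leq_mul2r cc orbT.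
Qed.

Lemma apprB X Y c c' s s' (S T : X -> Y) : appr c s S -> appr c' s' T ->
  appr (c + c') (fun k => s k + s' k) (S - T).
Proof.
move=> [lS sm SQ] [lT s'm TQ]; split; [exact: linear_opB|exact: noninc_ge0D|].
move=> k; have [Q fQ SQk] := SQ k; have [P fP TPk] := TQ k.
exists (Q - P); first by rewrite mulnDl; apply: frkB.
rewrite subrACA.
exact: opbB.
Qed.

Lemma apprN X Y c s (T : X -> Y) : appr c s T -> appr c s (- T).
Proof.
move=> [lT sm TQ]; split => //; first exact: linear_opN.
move=> k; have [Q fQ TQk] := TQ k; exists (- Q); first exact: frkN.
by rewrite -opprD; apply: opbN.
Qed.

Lemma apprD X Y c c' s s' (S T : X -> Y) : appr c s S -> appr c' s' T ->
  appr (c + c') (fun k => s k + s' k) (S + T).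
Proof. by move=> aS /apprN aT; have := apprB aS aT; rewrite opprK. Qed.

(** The error of ST is the product of the errors of S and T: ST differs from
   (S - Q)(T - P) by QT + (S - Q)P. *)
Lemma appr_comp X Y Z c c' s s' (S : Y -> Z) (T : X -> Y) :
  appr c s S -> appr c' s' T ->
  appr (c + c') (fun k => s k * s' k) (S \o T).
Proof.
move=> aS aT; have bT := appr_bounded aT.
case: aS aT => [lS sm SQ] [lT s'm TQ].
split; [exact: linear_op_comp|exact: noninc_ge0M|].
move=> k; have [Q fQ SQk] := SQ k; have [P fP TPk] := TQ k.
have [lQ _] := frk_bounded fQ.
exists ((Q \o T) + ((S - Q) \o P)).
  rewrite mulnDl; apply: frkD; first exact: frk_compr.
  by apply: frk_compl => //; apply: linear_opB.
have -> : (S \o T) - ((Q \o T) + ((S - Q) \o P)) = (S - Q) \o (T - P).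
  apply/funext => x; change (S (T x) - (Q (T x) + (S (P x) - Q (P x))) =
    S (T x - P x) - Q (T x - P x)).
  rewrite (linB lS) (linB lQ) opprD !opprB addrA addrACA [RHS]addrACA.
  by rewrite [- Q (T x) - _]addrC.
by apply: opb_comp => //; apply: sm.1.
Qed.

Lemma appr_of_opb X Y (T : X -> Y) (M : R) : linear T -> 0 <= M -> opb T M ->
  appr 0 (fun=> M) T.
Proof.
move=> lT M0 TM; split => // k; exists 0; first by rewrite mul0n; apply: frk0.
by rewrite subr0.
Qed.

Lemma appr_of_bounded X Y (T : X -> Y) : bounded_op T ->
  exists2 M : R, 0 <= M & appr 0 (fun=> M) T.
Proof.
by move=> /bounded_opP[lT [M M0 TM]]; exists M => //; apply: appr_of_opb.
Qed.

(** Traded for a slower decay of s, the factor c may be taken equal to 1. *)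
Lemma appr_divn X Y c s (T : X -> Y) : appr c s T ->
  appr 1 (fun k => s (k %/ c)%N) T.
Proof.
move=> [lT [s0 sm] TQ]; split => //.
  by split=> // i j ij; apply: sm; apply: leq_div2r.
move=> k; have [Q fQ TQk] := TQ (k %/ c)%N; exists Q => //.
by apply: frk_le fQ; rewrite mul1n mulnC leq_trunc_div.
Qed.

(** T is trace class, with quasi-norm at most B. *)
Definition tclass X Y (T : X -> Y) (B : R) : Prop :=
  exists2 s, appr 1 s T & sum_le s B.

Lemma tclass_appr X Y c s B (T : X -> Y) : (0 < c)%N -> appr c s T ->
  sum_le s B -> tclass T (c%:R * B).
Proof.
move=> c0 aT sB; exists (fun k => s (k %/ c)%N); first exact: appr_divn.
by apply: sum_le_divn => //; case: aT => _ [].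
Qed.

Lemma tclass_appr_ex X Y c s B (T : X -> Y) : appr c s T -> sum_le s B ->
  exists B', tclass T B'.
Proof.
move=> aT sB; exists (c.+1%:R * B); apply: tclass_appr sB => //.
by have [_ sm _] := aT; apply: appr_le aT.
Qed.

Lemma tclass_le X Y (T : X -> Y) B B' : B <= B' -> tclass T B -> tclass T B'.
Proof. by move=> BB [s aT sB]; exists s => // n; apply: le_trans (sB n) BB. Qed.

Lemma tclassN X Y (T : X -> Y) B : tclass T B -> tclass (- T) B.
Proof. by move=> [s aT sB]; exists s => //; apply: apprN. Qed.

Lemma tclassB X Y (S T : X -> Y) A B :
  tclass S A -> tclass T B -> tclass (S - T) (2 * (A + B)).
Proof.
move=> [s aS sA] [t aT tB]; apply: tclass_appr (apprB aS aT) _ => // n.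
by rewrite big_split /=; apply: lerD; [exact: sA|exact: tB].
Qed.

Lemma tclass0 X Y (B : R) : 0 <= B -> tclass (0 : X -> Y) B.
Proof.
move=> B0; exists (fun=> 0) => [|n]; last by rewrite big1.
apply: appr_le (appr_of_opb (@linear_op0 _ _ _) (lexx 0) (@opb0 _ _ _)) => //.
Qed.

Lemma tclass_compr X Y Z (S : Y -> Z) (T : X -> Y) B : tclass S B ->
  bounded_op T -> exists B', tclass (S \o T) B'.
Proof.
move=> [s aS sB] /appr_of_bounded[M M0 aT].
apply: (tclass_appr_ex (B := B * M) (appr_comp aS aT)) => n.
by rewrite -mulr_suml ler_wpM2r.
Qed.

Lemma tclass_compl X Y Z (S : Y -> Z) (T : X -> Y) B : tclass T B ->
  bounded_op S -> exists B', tclass (S \o T) B'.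
Proof.
move=> [s aT sB] /appr_of_bounded[M M0 aS].
apply: (tclass_appr_ex (B := M * B) (appr_comp aS aT)) => n.
by rewrite -mulr_sumr ler_wpM2l.
Qed.

(** If Q is the N-th approximant of A, then A - Q has the error sequence
   t_k = min (s_N, s_k), up to a factor in the ranks. The sum of the t_k s'_k is
   small for large N, by dominated convergence. *)
Lemma appr_density X c c' s s' (A B : X -> X) (C e : R) :
  appr c s A -> appr c' s' B ->
  (forall d, 0 < d -> exists N, s N < d) ->
  sum_le (fun k => s k * s' k) C -> 0 < e ->
  exists2 Q : X -> X, (exists k, frk k Q) &
    tclass ((A - Q) \o B) e /\ tclass (B \o (A - Q)) e.
Proof.
move=> aA aB sto0 ss' e0.
have [lA [s0 sm] AQ] := aA; have [lB [s'0 s'm] _] := aB.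
pose m := (c + c + c').+1.
pose d := e / m%:R; have d0 : 0 < d by rewrite divr_gt0.
have d20 : 0 < d / 2 by rewrite divr_gt0.
have ss'0 k : 0 <= s k * s' k by rewrite mulr_ge0.
have [N0 N0P] := sum_le_tail ss'0 ss' d20.
pose S' := \sum_(k < N0) s' k.
have S'0 : 0 <= S' by apply: sumr_ge0.
have [N NP] : exists N, s N * S' <= d / 2.
  have [|N NP] := sto0 (d / 2 / (S' + 1)); first by rewrite divr_gt0// ltr_wpDl.
  exists N; apply: (@le_trans _ _ (s N * (S' + 1))).
    by rewrite ler_wpM2l// lerDl.
  by rewrite -ler_pdivlMr ?ltW// ltr_wpDl.
have [Q fQ AQN] := AQ N.
exists Q; first by exists (c * N)%N.
pose t k := if (k <= N)%N then s N else s k.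
have tm : noninc_ge0 t.
  split=> [k|i j ij]; first by rewrite /t; case: ifP.
  rewrite /t; case: leqP => jN; case: leqP => iN.
  - by [].
  - by rewrite leqNgt (leq_trans iN ij) in jN.
  - by apply/sm/ltnW.
  - exact: sm.
have aAQ : appr (c + c) t (A - Q).
  split => //; first by apply: linear_opB => //; have [] := frk_bounded fQ.
  move=> k; rewrite /t; case: leqP => kN.
    exists 0; first by apply: frk_le (@frk0 _ _ _).
    by rewrite subr0.
  have [P fP APk] := AQ k; exists (P - Q).
    apply: frk_le (frkB fP fQ); rewrite mulnDl leq_add2l leq_mul2l.
    by rewrite ltnW ?orbT.
  by rewrite opprB addrA subrK.
have ts' : sum_le (fun k => t k * s' k) d.
  have ts k : t k <= s k by rewrite /t; case: leqP => // kN; apply: sm.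
  have tN k : t k <= s N by rewrite /t; case: leqP => // kN; apply/sm/ltnW.
  have ts'0 k : 0 <= t k * s' k by rewrite mulr_ge0//; apply: tm.1.
  move=> n; apply: (le_trans (sum_le_mono (m := (N0 + n)%N) ts'0 (leq_addl _ _))).
  rewrite -(big_mkord xpredT (fun k => t k * s' k)).
  rewrite (big_cat_nat (n := N0)) ?leq_addr//= (splitr d); apply: lerD.
    rewrite big_mkord; apply: le_trans NP; rewrite /S' mulr_sumr.
    by apply: ler_sum => k _; apply: ler_wpM2r.
  apply: le_trans (N0P (N0 + n)%N).
  by apply: ler_sum => k _; apply: ler_wpM2r.
have -> : e = m%:R * d by rewrite /d mulrC divfK// pnatr_eq0.
have nts' : noninc_ge0 (fun k => t k * s' k) by apply: noninc_ge0M => //; split.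
split; apply: (@tclass_appr _ _ m (fun k => t k * s' k)) => //.
  by apply: appr_le (appr_comp aAQ aB).
apply: appr_le (appr_comp aB aAQ) => //; first by rewrite addnC leqnSn.
by move=> k; rewrite mulrC.
Qed.

End Approximable.

Section ApproximationNumbers.
Variable R : realType.
Implicit Types X Y : normedModType R[i].

Lemma opnorm_ge0 X Y (T : X -> Y) : 0 <= opnorm T.
Proof.
rewrite /opnorm; have [->|/set0P T0] := eqVneq (op_bounds T) set0.
  by rewrite inf0.
by apply: lb_le_inf => // M [].
Qed.

Lemma opnorm_le X Y (T : X -> Y) M : 0 <= M -> opb T M -> opnorm T <= M.
Proof.
move=> M0 TM; apply: ge_inf; last by split.
by exists 0 => N [].
Qed.

Lemma opnormP X Y (T : X -> Y) : bounded_op T -> opb T (opnorm T).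
Proof.
move=> [_ T0] x; have [->|x0] := eqVneq x 0.
  rewrite nrm0 mulr0; have [M [_ /(_ 0)]] := T0; by rewrite nrm0 mulr0.
have xp := nrm_gt0 x0; rewrite -ler_pdivrMr//.
by apply: lb_le_inf => // M [_ /(_ x)]; rewrite ler_pdivrMr.
Qed.

Lemma approx_number_ge0 X Y k (T : X -> Y) : 0 <= approx_number k T.
Proof.
rewrite /approx_number.
have [->|/set0P A0] := eqVneq [set opnorm (fun x => T x - S x) |
       S in [set S : X -> Y | bounded_op S /\ rank_lt S k]] set0.
  by rewrite inf0.
by apply: lb_le_inf => // _ [S _ <-]; apply: opnorm_ge0.
Qed.

Lemma approx_number_le X Y k (T Q : X -> Y) M : frk k Q -> 0 <= M ->
  opb (T - Q) M -> approx_number k.+1 T <= M.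
Proof.
move=> /frkP fQ M0 TQ; apply: le_trans (opnorm_le M0 TQ).
apply: ge_inf; last by exists Q.
by exists 0 => _ [S _ <-]; apply: opnorm_ge0.
Qed.

(** The infimum that defines approximation numbers need not be attained, hence e. *)
Lemma approx_number_approx X Y k (T : X -> Y) e : bounded_op T -> 0 < e ->
  exists2 Q : X -> Y, frk k Q & opb (T - Q) (approx_number k.+1 T + e).
Proof.
move=> bT e0.
have hi : has_inf [set opnorm (fun x => T x - S x) |
       S in [set S : X -> Y | bounded_op S /\ rank_lt S k.+1]].
  split; last by exists 0 => _ [S _ <-]; apply: opnorm_ge0.
  exists (opnorm (fun x => T x - (0 : X -> Y) x)), 0 => //.
  by apply/frkP; apply: frk_le (@frk0 _ _ _).
have [_ [Q fQ <-] TQ] := inf_adherent e0 hi.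
exists Q; first exact/frkP.
apply: opb_le (ltW TQ) _.
by apply: (@opnormP _ _ (T - Q)); apply: boundedB => //; case: fQ.
Qed.

Lemma approx_number_noninc X Y k l (T : X -> Y) : bounded_op T -> (k <= l)%N ->
  approx_number l.+1 T <= approx_number k.+1 T.
Proof.
move=> bT kl; apply/ler_addgt0Pl => e e0; rewrite addrC.
have [Q fQ TQ] := approx_number_approx k bT e0.
apply: approx_number_le TQ; first exact: frk_le fQ.
by rewrite addr_ge0 ?approx_number_ge0// ltW.
Qed.

Lemma sum_geometric_half n : \sum_(k < n) (2^-1 : R) ^+ k.+1 <= 1.
Proof.
suff -> : \sum_(k < n) (2^-1 : R) ^+ k.+1 = 1 - 2^-1 ^+ n.
  by rewrite gerBl exprn_ge0.
elim: n => [|n IH]; first by rewrite big_ord0 expr0 subrr.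
by rewrite big_ord_recr /= IH exprS; field.
Qed.

Lemma cvgn_series_sum_le (s : nat -> R) B : (forall k, 0 <= s k) ->
  sum_le s B -> cvgn (series s) /\ limn (series s) <= B.
Proof.
move=> s0 sB.
have sE n : series s n = \sum_(k < n) s k by rewrite /series /= big_mkord.
have cs : cvgn (series s).
  apply: nondecreasing_is_cvgn.
    by move=> i j ij; rewrite !sE; apply: sum_le_mono.
  by exists B => _ [n _ <-]; rewrite sE.
by split => //; apply: limr_le => //; apply: nearW => n; rewrite sE.
Qed.

Lemma sum_le_cvgn_series (s : nat -> R) : (forall k, 0 <= s k) ->
  cvgn (series s) -> sum_le s (limn (series s)).
Proof.
move=> s0 cs n.
have sE m : series s m = \sum_(k < m) s k by rewrite /series /= big_mkord.
rewrite -sE; apply: nondecreasing_cvgn_le => // i j ij.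
by rewrite !sE; apply: sum_le_mono.
Qed.

(** The gap between the norm of T and B is distributed over the approximation
   numbers as a geometric series, so that each of them is exceeded strictly. *)
Lemma S_app1_tclass X (T : X -> X) B : S_app 1 T -> S1_norm T < B -> tclass T B.
Proof.
move=> [bT]; under eq_fun do rewrite powRr1 ?approx_number_ge0//.
move=> cT TB; pose a k := approx_number k.+1 T.
pose e := B - S1_norm T; have e0 : 0 < e by rewrite subr_gt0.
have a0 k : 0 <= a k by apply: approx_number_ge0.
have [lT _] := bT.
exists (fun k => a k + e * 2^-1 ^+ k.+1).
  split => //.
    apply: noninc_ge0D; first by split=> // i j ij; apply: approx_number_noninc.
    split=> [k|i j ij]; first by rewrite mulr_ge0 ?exprn_ge0// ltW.
    by rewrite ler_wpM2l ?(ltW e0)// ler_wiXn2l// ?invr_ge0// invf_le1// ler1n.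
  move=> k; rewrite mul1n; apply: approx_number_approx => //.
  by rewrite mulr_gt0// exprn_gt0.
move=> n; rewrite big_split /= -mulr_sumr.
have := sum_le_cvgn_series a0 cT n; rewrite -/(S1_norm T) => h.
have : e * (\sum_(i < n) 2^-1 ^+ i.+1) <= e.
  by rewrite -[leRHS]mulr1 ler_wpM2l ?(ltW e0)// sum_geometric_half.
by rewrite /e; lra.
Qed.

Lemma tclass_S_app1 X (T : X -> X) B : tclass T B -> S_app 1 T /\ S1_norm T <= B.
Proof.
move=> [s aT sB]; have bT := appr_bounded aT.
have a0 k : 0 <= approx_number k.+1 T by apply: approx_number_ge0.
have [lT [s0 _] TQ] := aT.
have aB : sum_le (fun k => approx_number k.+1 T) B.
  move=> n; apply: le_trans (sB n); apply: ler_sum => k _.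
  have [Q fQ TQk] := TQ k; apply: approx_number_le TQk => //.
  by rewrite mul1n in fQ.
have [cT lT'] := cvgn_series_sum_le a0 aB.
split; last exact: lT'.
by split => //; under eq_fun do rewrite powRr1//.
Qed.

(** The q-th powers of the approximation numbers are enlarged by a geometric
   series, which leaves room for approximants; the resulting sequence is bounded,
   so that its p-th powers are at most a constant times its q-th powers. *)
Lemma S_app_appr X Y (q : R) (p : nat) (T : X -> Y) : 0 < q -> q <= p%:R ->
  S_app q T -> exists2 s, appr 1 s T & exists B, sum_le (fun k => s k ^+ p) B.
Proof.
move=> q0 qp [bT cT]; pose a k := approx_number k.+1 T.
have a0 k : 0 <= a k by apply: approx_number_ge0.
pose b k := a k `^ q + 2^-1 ^+ k.+1.
have b0 k : 0 < b k by rewrite ltr_wpDl ?powR_ge0// exprn_gt0.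
have [B bB] : exists B, sum_le b B.
  exists (limn (series (fun k => a k `^ q)) + 1) => n; rewrite big_split /=.
  apply: lerD; last exact: sum_geometric_half.
  by apply: (sum_le_cvgn_series _ cT) => k; apply: powR_ge0.
have bm i j : (i <= j)%N -> b j <= b i.
  move=> ij; apply: lerD.
    by apply: ge0_ler_powR; rewrite ?nnegrE ?(ltW q0)//; apply: approx_number_noninc.
  by rewrite ler_wiXn2l// ?invr_ge0// invf_le1// ler1n.
pose s k := b k `^ q^-1.
have [lT _] := bT.
have qV0 : 0 <= q^-1 by rewrite invr_ge0 ltW.
exists s.
  split => //.
    split=> [k|i j ij]; first exact: powR_ge0.
    by apply: ge0_ler_powR; rewrite ?nnegrE ?(ltW (b0 _))//; apply: bm.
  move=> k; have as_lt : a k < s k.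
    have -> : a k = (a k `^ q) `^ q^-1 by rewrite -powRrM mulfV ?gt_eqF// powRr1.
    apply: gt0_ltr_powR; rewrite ?invr_gt0// ?nnegrE ?powR_ge0 ?(ltW (b0 _))//.
    by rewrite ltrDl exprn_gt0.
  have [|Q fQ TQ] := @approx_number_approx _ _ k T (s k - a k) bT.
    by rewrite subr_gt0.
  exists Q; first by rewrite mul1n.
  by have -> : s k = approx_number k.+1 T + (s k - a k) by rewrite addrC subrK.
have B0 := sum_le_ge0 bB.
exists (B `^ (p%:R / q - 1) * B) => n.
apply: (@le_trans _ _ (\sum_(k < n) B `^ (p%:R / q - 1) * b k)); last first.
  by rewrite -mulr_sumr ler_wpM2l ?powR_ge0.
apply: ler_sum => k _.
have -> : s k ^+ p = b k `^ (p%:R / q - 1) * b k.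
  rewrite /s -powR_mulrn ?powR_ge0// -powRrM [q^-1 * _]mulrC.
  have -> : b k `^ (p%:R / q - 1) * b k = b k `^ (p%:R / q - 1) * b k `^ 1.
    by rewrite powRr1// ltW.
  rewrite -(@powRD _ _ (p%:R / q - 1) 1) ?(gt_eqF (b0 k)) ?implybT//.
  by rewrite subrK.
rewrite ler_wpM2r ?(ltW (b0 k))//; apply: ge0_ler_powR.
- by rewrite subr_ge0 ler_pdivlMr// mul1r.
- by rewrite nnegrE ltW.
- by rewrite nnegrE.
- have := bB k.+1; rewrite big_ord_recr /=; apply: le_trans.
  by rewrite lerDr; apply: sumr_ge0 => j _; apply: ltW.
Qed.

End ApproximationNumbers.

(** * The trace on trace-class operators *)

Section Trace.
Variables (R : realType) (X : normedModType R[i]).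
Implicit Types S T Q : X -> X.

(** The trace is controlled by the approximation numbers: D is the sum of the
   differences of its approximants of ranks 1, 2, 4, ..., each of which
   contributes at most its rank times its norm. *)
Lemma rank_trace_tclass k (D : X -> X) d B :
  rank_trace k D d -> tclass D B -> cabs d <= 12 * B.
Proof.
move=> Dd [s aD sB]; have sD := appr_opb aD; have [lD sm DQ] := aD.
have [s0 smm] := sm.
have /choice[Q QP] j : exists Q : X -> X, frk (2 ^ j) Q /\ opb (D - Q) (s (2 ^ j)%N).
  by have [Q fQ DQj] := DQ (2 ^ j)%N; exists Q; rewrite mul1n in fQ.
have /choice[q qP] j : exists q, rank_trace (2 ^ j) (Q j) q.
  have [[phi [x [phib QE]]] _] := QP j.
  by exists (\sum_i phi i (x i)), phi, x; split => // i; have [] := phib i.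
have q_bound j : cabs (q j) <=
    s 0%N + s 1%N + \sum_(i < j) 6 * (2 ^+ i * s (2 ^ i)%N).
  elim: j => [|j IH].
    rewrite big_ord0 addr0.
    have := rank_trace_bound (qP 0%N) (M := s 0%N + s 1%N); rewrite mul1r; apply.
      exact: addr_ge0.
    have -> : Q 0%N = D - (D - Q 0%N) by rewrite opprB addrC subrK.
    by apply: opbB => //; have [_] := QP 0%N.
  rewrite big_ord_recr /= addrA.
  have -> : q j.+1 = q j + (q j.+1 - q j) by rewrite addrC subrK.
  apply: le_trans (cabsD _ _) _; apply: lerD => //.
  have h : opb (Q j.+1 - Q j) (s (2 ^ j)%N + s (2 ^ j)%N).
    have -> : Q j.+1 - Q j = (D - Q j) - (D - Q j.+1).
      by rewrite opprB [RHS]addrC addrA subrK.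
    apply: opbB; first by have [] := QP j.
    by have [_] := QP j.+1; apply: opb_le; apply: smm; rewrite leq_pexp2l.
  apply: le_trans (rank_trace_bound (rank_traceB (qP j.+1) (qP j)) _ h) _.
    exact: addr_ge0.
  by rewrite natrD !natrX exprS; lra.
pose J := k; have kJ : (k <= 2 ^ J)%N by rewrite ltnW// ltn_expl.
have dq : cabs (d - q J) <= 2 * (2 ^+ J * s (2 ^ J)%N).
  have [_ DJ] := QP J.
  apply: le_trans (rank_trace_bound (rank_traceB Dd (qP J)) (s0 _) DJ) _.
  rewrite mulrA ler_wpM2r// natrD -natrX.
  have : (k%:R : R) <= (2 ^ J)%:R by rewrite ler_nat.
  by lra.
have : cabs d <= cabs (d - q J) + cabs (q J) by apply: le_trans (cabsD _ _); rewrite subrK.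
have := q_bound J; have := sum_condensation J sm.
have : s 0%N + \sum_(i < 2 ^ J) s i.+1 <= B.
  by have := sB (2 ^ J).+1; rewrite big_ord_recl.
rewrite big_ord_recr /= -mulr_sumr.
have := smm 0%N 1%N isT.
set U := \sum_(_ < _) _; set V := \sum_(_ < _) _.
have : 0 <= V by apply: sumr_ge0 => i _; rewrite mulr_ge0// exprn_ge0.
have : 0 <= 2 ^+ J * s (2 ^ J)%N by rewrite mulr_ge0// exprn_ge0.
have := s0 0%N; lra.
Qed.

(** t is the limit of the traces of the finite-rank operators that tend to T. *)
Definition has_trace T (t : R[i]) : Prop :=
  forall e : R, 0 < e -> exists Q q,
    [/\ has_finite_trace Q q, tclass (T - Q) e & cabs (q - t) < e].

(** Both traces are limits of finite-rank traces, and the difference of the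
   approximants is close to T - T'; the quasi-triangle inequality [tclassB]
   turns the constant 12 into 24. *)
Lemma has_trace_close T T' t t' B : has_trace T t -> has_trace T' t' ->
  tclass (T - T') B -> cabs (t - t') <= 24 * B.
Proof.
move=> Tt T't' TT; apply/ler_addgt0Pl => d d0.
(* 98 = 12 * 8 + 2: the errors enter once through the quasi-norms and once
   directly. *)
pose e := d / 98; have e0 : 0 < e by rewrite divr_gt0.
have [Q [q [Qq TQ qt]]] := Tt _ e0; have [Q' [q' [Qq' TQ' qt']]] := T't' _ e0.
have := tclassB TT (tclassB TQ TQ').
have -> : T - T' - (T - Q - (T' - Q')) = Q - Q'.
  by rewrite subrACA !subKr_diff.
have [k Qk] := has_finite_rank_trace Qq; have [k' Qk'] := has_finite_rank_trace Qq'.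
move=> /(rank_trace_tclass (rank_traceB Qk Qk')).
have -> : t - t' = (q - q') - ((q - t) - (q' - t')) by ring.
move=> h; apply: le_trans (cabsB _ _) _.
have := cabsB (q - t) (q' - t').
have : d = 98 * e by rewrite /e; field.
by lra.
Qed.

Lemma has_trace_uniq T t t' : has_trace T t -> has_trace T t' -> t = t'.
Proof.
move=> Tt Tt'; apply/eqP; rewrite -subr_eq0; apply/eqP/cabs_eq0/eqP.
rewrite eq_le cabs_ge0 andbT.
have := has_trace_close Tt Tt' (B := 0); rewrite mulr0; apply.
by rewrite subrr; apply: tclass0.
Qed.

Lemma has_trace_finite T t : has_finite_trace T t -> has_trace T t.
Proof.
move=> Tt e e0; exists T, t; split => //; last by rewrite subrr cabs0.
by rewrite subrr; apply/tclass0/ltW.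
Qed.

Lemma tclass_density T B e : tclass T B -> 0 < e ->
  exists2 Q, (exists k, frk k Q) & tclass (T - Q) e.
Proof.
move=> [s aT sB] e0; have [s0 sm] : noninc_ge0 s by case: aT.
have aI : appr 0 (fun=> 1) (idfun : X -> X).
  by apply: appr_of_opb => // x; rewrite mul1r.
have [|n|Q fQ [TQ _]] := appr_density (C := B) aT aI _ _ e0.
- move=> d d0; have [N NP] := sum_le_tail s0 sB (divr_gt0 d0 (ltr0Sn R 1)).
  exists N; have := NP N.+1; rewrite big_nat1; lra.
- by under eq_bigr do rewrite mulr1; apply: sB.
- by exists Q.
Qed.

Lemma has_trace_ex T B : tclass T B -> exists t, has_trace T t.
Proof.
move=> TB.
have /choice[Qq QqP] n : exists Qq : (X -> X) * R[i],
    has_finite_trace Qq.1 Qq.2 /\ tclass (T - Qq.1) n.+1%:R^-1.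
  have [|Q [k fQ] TQ] := tclass_density (e := n.+1%:R^-1) TB; first by rewrite invr_gt0.
  by have [q Qq] := frk_trace fQ; exists (Q, q).
have [|t tP] := @complex_nrm_complete R (fun n => (Qq n).2).
  move=> e e0; have e'0 : 0 < e / 48 by rewrite divr_gt0.
  have [N NP] := eps_inv (divr_gt0 e'0 (ltr0Sn R 1)); exists N => i j Ni Nj.
  have [Qi TQi] := QqP i; have [Qj TQj] := QqP j.
  have [k Qk] := has_finite_rank_trace Qi; have [l Ql] := has_finite_rank_trace Qj.
  have := tclassB TQj TQi.
  have -> : T - (Qq j).1 - (T - (Qq i).1) = (Qq i).1 - (Qq j).1.
    by rewrite opprB addrC addrA subrK.
  move=> /(rank_trace_tclass (rank_traceB Qk Ql)).
  have := NP i Ni; have := NP j Nj; change (nrm (_ : R[i]^o)) with (cabs ((Qq i).2 - (Qq j).2)).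
  by move: (j.+1%:R^-1 : R) (i.+1%:R^-1 : R) => a b; lra.
exists t => e e0; have [N NP] := tP e e0; have [M MP] := eps_inv e0.
have [Qt TQ] := QqP (maxn N M).
exists (Qq (maxn N M)).1, (Qq (maxn N M)).2; split => //.
  apply: tclass_le TQ; apply/ltW/MP; exact: leq_maxr.
by apply: NP; apply: leq_maxl.
Qed.

Lemma has_traceB T T' t t' : has_trace T t -> has_trace T' t' ->
  has_trace (T - T') (t - t').
Proof.
move=> Tt T't' e e0; have e40 : 0 < e / 4 by rewrite divr_gt0.
have [Q [q [Qq TQ qt]]] := Tt _ e40; have [Q' [q' [Qq' TQ' qt']]] := T't' _ e40.
exists (Q - Q'), (q - q'); split.
- have [k fQ] := has_finite_trace_frk Qq; have [k' fQ'] := has_finite_trace_frk Qq'.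
  have [r Qr] := frk_trace (frkB fQ fQ').
  have [l Ql] := has_finite_rank_trace Qr.
  have [m Qm] := has_finite_rank_trace Qq; have [m' Qm'] := has_finite_rank_trace Qq'.
  by rewrite (rank_trace_uniq (rank_traceB Qm Qm') Ql).
- have -> : e = 2 * (e / 4 + e / 4) by field.
  rewrite subrACA.
  exact: tclassB.
- have -> : q - q' - (t - t') = (q - t) - (q' - t') by ring.
  have := cabsB (q - t) (q' - t'); lra.
Qed.

(** The traces of QT and TQ agree for Q of finite rank; by [appr_density], S may be
   approximated by such Q for both products at once. As in Hoelder's
   inequality, summability is required of the product of the error sequences. *)
Lemma has_trace_comm c c' s s' S T C t :
  appr c s S -> appr c' s' T -> (forall d, 0 < d -> exists N, s N < d) ->
  sum_le (fun k => s k * s' k) C ->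
  has_trace (S \o T) t -> has_trace (T \o S) t.
Proof.
move=> aS aT sto0 ss' STt.
have [B TSB] : exists B, tclass (T \o S) B.
  apply: (tclass_appr_ex (B := C) (appr_comp aT aS)) => n.
  by under eq_bigr do rewrite mulrC; apply: ss'.
have [t' TSt'] := has_trace_ex TSB.
suff -> : t = t' by [].
apply/eqP; rewrite -subr_eq0; apply/eqP/cabs_eq0/eqP.
rewrite eq_le cabs_ge0 andbT; apply/ler_addgt0Pl => d d0; rewrite addr0.
have d480 : 0 < d / 48 by rewrite divr_gt0.
have [Q [k fQ] [SQT TSQ]] := appr_density aS aT sto0 ss' d480.
have bT := appr_bounded aT; have [lT _] := bT.
have [r [QTr TQr]] := frk_trace_comm fQ bT.
have h1 := has_trace_close STt (has_trace_finite QTr) SQT.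
have h2 : cabs (t' - r) <= 24 * (d / 48).
  apply: (has_trace_close TSt' (has_trace_finite TQr)).
  suff -> : (T \o S) - (T \o Q) = T \o (S - Q) by [].
  by apply/funext => x; rewrite [RHS](linB lT).
have -> : t - t' = (t - r) - (t' - r) by ring.
by apply: le_trans (cabsB _ _) _; lra.
Qed.

Lemma has_trace_comm_bounded S T B t : tclass S B -> bounded_op T ->
  has_trace (S \o T) t -> has_trace (T \o S) t.
Proof.
move=> [s aS sB] /appr_of_bounded[M M0 aT].
have [_ [s0 sm] _] := aS.
apply: (has_trace_comm aS aT (C := B * M)).
  move=> d d0; have [N NP] := sum_le_tail s0 sB (divr_gt0 d0 (ltr0Sn R 1)).
  by exists N; have := NP N.+1; rewrite big_nat1; lra.
by move=> n; rewrite -mulr_suml ler_wpM2r.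
Qed.

Lemma trace_extension_ex : trace_extension (fun T => xget 0 (has_trace T)).
Proof.
have tauP T t : has_trace T t -> xget 0 (has_trace T) = t.
  move=> Tt; case: xgetP => [t' _ Tt'|/(_ t)//].
  exact: has_trace_uniq Tt' Tt.
split=> [T t /has_trace_finite/tauP//|T aT e e0].
exists (e / 48); first by rewrite divr_gt0.
move=> S aS STe.
have [t Tt] := has_trace_ex (S_app1_tclass aT (ltr_pwDr ltr01 (lexx _))).
have [s Ss] := has_trace_ex (S_app1_tclass aS (ltr_pwDr ltr01 (lexx _))).
rewrite (tauP _ _ Tt) (tauP _ _ Ss) normc_lt.
have [BT TB] : exists B, tclass T B.
  exists (S1_norm T + 1); apply: S_app1_tclass aT _; by rewrite ltrDl.
have [BS SB] : exists B, tclass S B.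
  exists (S1_norm S + 1); apply: S_app1_tclass aS _; by rewrite ltrDl.
have [aST _] := tclass_S_app1 (tclassB SB TB).
have ST := S_app1_tclass aST STe.
have := has_trace_close Ss Tt ST; lra.
Qed.

Lemma app_trace_extension : trace_extension (@app_trace R X).
Proof.
rewrite /app_trace; case: xgetP => [tau _ //|].
by move=> /(_ _ trace_extension_ex).
Qed.

(** By density, continuity forces any extension of the trace to agree with the
   limit of finite-rank traces. *)
Lemma app_traceE T B t : tclass T B -> has_trace T t -> app_trace T = t.
Proof.
move=> TB Tt; have [tau_fin tau_cont] := app_trace_extension.
suff Ttau : has_trace T (app_trace T) by apply: has_trace_uniq Ttau Tt.
move=> e e0; have [aT _] := tclass_S_app1 TB.
have [d d0 dP] := tau_cont T aT e e0.
have m0 : 0 < Num.min (d / 2) e by rewrite lt_min e0 divr_gt0.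
have [Q [k fQ] TQ] := tclass_density TB m0.
have [q Qq] := frk_trace fQ.
have QT := tclassN TQ; rewrite opprB in QT.
have [_ QTd] := tclass_S_app1 QT.
exists Q, q; split => //; first by apply: tclass_le TQ; rewrite ge_min lexx orbT.
rewrite -(tau_fin _ _ Qq) -normc_lt; apply: dP.
  have [aQ _] := tclass_S_app1 (tclassB TB TQ).
  by rewrite opprB addrC subrK in aQ.
apply: le_lt_trans QTd _; rewrite gt_min; apply/orP; left; lra.
Qed.

End Trace.

(** * The index as a difference of traces *)

Section Index.
Variables (R : realType) (Y : normedModType R[i]).
Implicit Types S T L : Y -> Y.

(** The zeroth term of an error sequence bounds the norm. *)
Lemma tclass_opb T (B : R) : tclass T B -> opb T B.
Proof.
move=> [s aT sB]; apply: opb_le (appr_opb aT).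
by have := sB 1%N; rewrite big_ord1.
Qed.

Lemma frk_basis k T : frk k T -> exists r (e : 'I_r -> Y) (phi : 'I_r -> Y -> R[i]^o),
  [/\ free_mod [set 0] e, forall i, exists y, e i = T y,
      forall i, bounded_op (phi i) & forall y, T y = \sum_i phi i y *: e i].
Proof.
move=> fT; have bT := frk_bounded fT.
have [_ [r _ [e [eT fe es]]]] := (frkP _ _).1 fT.
have [|phi [phib TE]] := frk_coords bT fe.
  move=> y; have [|c /= /eqP] := es (T y); first by exists y.
  by rewrite subr_eq0 => /eqP ->; exists c.
by exists r, e, phi; split => // i; have [y _ <-] := eT i; exists y.
Qed.

Lemma has_index_finite_trace T S k l r1 r2 : linear T -> linear S ->
  frk k (idfun - (S \o T)) -> frk l (idfun - (T \o S)) ->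
  has_finite_trace (idfun - (S \o T)) r1 -> has_finite_trace (idfun - (T \o S)) r2 ->
  exists2 z : int, has_index T z & r1 - r2 = z%:~R.
Proof.
move=> lT lS f1 f2 E1r E2r.
have [m [e [psi [fe eR psib psiE]]]] := frk_basis f1.
have [n [f [chi [ff fR chib chiE]]]] := frk_basis f2.
have [iT tr] := has_index_finite_rank lT lS fe ff eR fR psiE chiE.
exists (m%:Z - n%:Z) => //.
have [a E1a] := has_finite_rank_trace E1r; have [b E2b] := has_finite_rank_trace E2r.
rewrite intrB -!pmulrn -tr; congr (_ - _).
  apply: (rank_trace_uniq E1a (k' := m)); exists psi, e; split => // i.
  by have [] := psib i.
apply: (rank_trace_uniq E2b (k' := n)); exists chi, f; split => // i.
by have [] := chib i.
Qed.

(** Let Q be a finite-rank operator close to 1 - ST and D = 1 - ST - Q. With G the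
   inverse of 1 - D, the operator GS inverts T up to GQ on the left; it does so up
   to finite rank on the right too, because it differs by finite rank from a right
   inverse modulo finite rank, obtained in the same way. The correction
   d = GS - S = DGS is of trace class, and the traces of dT and Td agree. *)
Lemma has_index_trace T S B1 B2 t1 t2 : nrm_complete Y ->
  bounded_op T -> bounded_op S ->
  tclass (idfun - (S \o T)) B1 -> tclass (idfun - (T \o S)) B2 ->
  has_trace (idfun - (S \o T)) t1 -> has_trace (idfun - (T \o S)) t2 ->
  exists2 z : int, has_index T z & t1 - t2 = z%:~R.
Proof.
move=> cY bT bS L1B L2B; set L1 := idfun - (S \o T); set L2 := idfun - (T \o S).
move=> L1t L2t; have [lT _] := bT; have [lS _] := bS.
have half0 : (0 : R) < 2^-1 by rewrite invr_gt0.
have [Q [k fQ] DB] := tclass_density L1B half0.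
have [Q' [l fQ'] DB'] := tclass_density L2B half0.
set D := L1 - Q in DB; set D' := L2 - Q' in DB'.
have bD : bounded_op D by case: DB => s /appr_bounded.
have bD' : bounded_op D' by case: DB' => s /appr_bounded.
have [lD _] := bD; have [lD' _] := bD'.
have [lQ _] := frk_bounded fQ; have [lQ' _] := frk_bounded fQ'.
have [G [bG GD DG]] := neumann_inverse cY lD (tclass_opb DB).
have [G' [bG' GD' DG']] := neumann_inverse cY lD' (tclass_opb DB').
have [lG _] := bG; have [lG' _] := bG'.
pose S1 := G \o S; pose S2 := S \o G'.
have bS1 : bounded_op S1 by apply: bounded_comp.
have [lS1 _] := bS1.
have STE y : S (T y) = (y - D y) - Q y.
  by rewrite /D /L1 !fctE /= opprB addrA addrAC addrK subKr_diff.
have TSE y : T (S y) = (y - D' y) - Q' y.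
  by rewrite /D' /L2 !fctE /= opprB addrA addrAC addrK subKr_diff.
have E1 y : y - S1 (T y) = G (Q y).
  by rewrite /S1 /= STE (linB lG) GD subKr_diff.
have T2 y : y - T (S2 y) = Q' (G' y).
  by rewrite /S2 /= TSE DG' subKr_diff.
have S12 y : S1 y = S2 y - G (Q (S2 y)) + S1 (Q' (G' y)).
  by rewrite -E1 subKr_diff -T2 (linB lS1) addrC subrK.
have E2 y : y - T (S1 y) =
    Q' (G' y) + T (G (Q (S2 y))) - T (S1 (Q' (G' y))).
  rewrite S12 (linD lT) (linB lT) -T2 opprD addrA; congr (_ - _).
  by rewrite opprB addrCA addrA [in RHS]addrC addrA.
have f1 : frk k (idfun - (S1 \o T)).
  have -> : idfun - (S1 \o T) = G \o Q by apply/funext => y; rewrite /= -E1.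
  exact: frk_compl.
have f2 : frk (l + k + l) (idfun - (T \o S1)).
  have -> : idfun - (T \o S1) = (Q' \o G') + (T \o G \o Q \o S2) - (T \o S1 \o Q' \o G').
    by apply/funext => y; rewrite !fctE /= -E2.
  apply: frkB; first apply: frkD.
  - exact: frk_compr.
  - apply: frk_compr; first exact: bounded_comp.
    by apply: frk_compl => //; apply: linear_op_comp.
  - apply: frk_compr => //; apply: frk_compl => //.
    exact: linear_op_comp.
have [r1 E1r] := frk_trace f1; have [r2 E2r] := frk_trace f2.
have [z iT rz] := has_index_finite_trace lT lS1 f1 f2 E1r E2r.
exists z => //; rewrite -rz.
pose d := D \o (G \o S).
have dE y : d y = S1 y - S y by rewrite /d /S1 /= -{3}(DG (S y)) subKr_diff.
have [Bd dB] : exists B, tclass d B.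
  by apply: tclass_compr DB _; apply: bounded_comp.
have d1 : has_trace (d \o T) (t1 - r1).
  have := has_traceB L1t (has_trace_finite E1r).
  have -> : L1 - (idfun - (S1 \o T)) = d \o T.
    apply/funext => y; rewrite /= dE /L1 !fctE /=.
    by rewrite opprB addrC addrA subrK.
  by [].
have d2 : has_trace (T \o d) (t2 - r2).
  have := has_traceB L2t (has_trace_finite E2r).
  have -> : L2 - (idfun - (T \o S1)) = T \o d.
    apply/funext => y; rewrite /= dE /L2 !fctE /= (linB lT).
    by rewrite opprB addrC addrA subrK.
  by [].
have := has_trace_uniq (has_trace_comm_bounded dB bT d1) d2 => tr.
have -> : t1 - t2 = (t1 - r1) - (t2 - r2) + (r1 - r2) by ring.
by rewrite tr subrr add0r.
Qed.

End Index.

(** * Schatten-type ideals *)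

Section Ideal.
Variable R : realType.
Implicit Types X Y Z : normedModType R[i].

Definition pow_summable (p : nat) (s : nat -> R) : Prop :=
  noninc_ge0 s /\ exists B, sum_le (fun k => s k ^+ p) B.

(** The inequality (a + b)^p <= 2^p (a^p + b^p), by comparison with the larger of a
   and b. *)
Lemma pow_summableD p s t : pow_summable p s -> pow_summable p t ->
  pow_summable p (fun k => s k + t k).
Proof.
move=> [sm [A sA]] [tm [B tB]]; split; first exact: noninc_ge0D.
exists (2 ^+ p * (A + B)) => n.
apply: (@le_trans _ _ (\sum_(k < n) 2 ^+ p * (s k ^+ p + t k ^+ p))).
  apply: ler_sum => k _; have s0 := sm.1 k; have t0 := tm.1 k.
  have ineq (a b : R) : 0 <= a -> 0 <= b -> a <= b ->
      (a + b) ^+ p <= 2 ^+ p * (a ^+ p + b ^+ p).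
    move=> a0 b0 ab; apply: (@le_trans _ _ ((2 * b) ^+ p)).
      by rewrite lerXn2r// ?nnegrE; lra.
    by rewrite exprMn ler_wpM2l ?exprn_ge0// lerDr exprn_ge0.
  have [st|/ltW ts] := leP (s k) (t k); first exact: ineq.
  by rewrite addrC [X in _ * X]addrC; apply: ineq.
rewrite -mulr_sumr ler_wpM2l ?exprn_ge0// big_split /=.
by apply: lerD; [exact: sA|exact: tB].
Qed.

Lemma pow_summable0 p : (0 < p)%N -> pow_summable p (fun=> 0).
Proof. by move=> p0; split => //; exists 0 => n; rewrite big1// => k _; rewrite expr0n gtn_eqF. Qed.

Lemma pow_summableZ p s M : 0 <= M -> pow_summable p s ->
  pow_summable p (fun k => M * s k).
Proof.
move=> M0 [sm [B sB]]; split; first exact: noninc_ge0M.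
exists (M ^+ p * B) => n; under eq_bigr do rewrite exprMn.
by rewrite -mulr_sumr ler_wpM2l ?exprn_ge0.
Qed.

Lemma pow_summable_to0 p s : (0 < p)%N -> pow_summable p s ->
  forall d, 0 < d -> exists N, s N < d.
Proof.
move=> p0 [[s0 sm] [B sB]] d d0.
have dp0 : 0 < d ^+ p by rewrite exprn_gt0.
have [|N NP] := sum_le_tail _ sB (divr_gt0 dp0 (ltr0Sn R 1)).
  by move=> k; apply: exprn_ge0.
exists N; rewrite ltNge; apply/negP => ds.
have : d ^+ p <= s N ^+ p by rewrite lerXn2r// ?nnegrE// ltW.
by have := NP N.+1; rewrite big_nat1; lra.
Qed.

(** The operator ideal of p-summable approximation numbers, by means of error
   sequences and for a natural exponent. *)
Definition Sp X Y (p : nat) (T : X -> Y) : Prop :=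
  exists c s, pow_summable p s /\ appr c s T.

Lemma Sp_of_S_app X Y (q : R) p (T : X -> Y) : 0 < q -> q <= p%:R ->
  S_app q T -> Sp p T.
Proof.
move=> q0 qp /(S_app_appr q0 qp)[s aT sB]; exists 1%N, s; split => //.
by split => //; case: aT.
Qed.

Lemma Sp0 X Y p : (0 < p)%N -> Sp p (0 : X -> Y).
Proof.
move=> p0; exists 0%N, (fun=> 0); split; first exact: pow_summable0.
by apply: appr_of_opb => //; [exact: linear_op0|exact: opb0].
Qed.

Lemma SpD X Y p (S T : X -> Y) : Sp p S -> Sp p T -> Sp p (S + T).
Proof.
move=> [c [s [sp aS]]] [d [t [tp aT]]]; exists (c + d)%N, (fun k => s k + t k).
by split; [exact: pow_summableD|exact: apprD].
Qed.

Lemma Sp_compr X Y Z p (S : Y -> Z) (T : X -> Y) :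
  Sp p S -> bounded_op T -> Sp p (S \o T).
Proof.
move=> [c [s [sp aS]]] /appr_of_bounded[M M0 aT].
exists (c + 0)%N, (fun k => M * s k); split; first exact: pow_summableZ.
have -> : (fun k => M * s k) = (fun k => s k * M) by apply/funext => k; rewrite mulrC.
exact: appr_comp.
Qed.

Lemma Sp_compl X Y Z p (S : Y -> Z) (T : X -> Y) :
  Sp p T -> bounded_op S -> Sp p (S \o T).
Proof.
move=> [c [s [sp aT]]] /appr_of_bounded[M M0 aS].
exists (0 + c)%N, (fun k => M * s k); split; first exact: pow_summableZ.
exact: appr_comp.
Qed.

(** With a common sequence s, a product of j operators has the error sequence s^j. *)
Lemma Sp_common X Y Z (V : normedModType R[i]) p (S : X -> Y) (T : Z -> V) :
  Sp p S -> Sp p T -> exists c s, [/\ pow_summable p s, appr c s S & appr c s T].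
Proof.
move=> [c [s [sp aS]]] [d [t [tp aT]]]; exists (c + d)%N, (fun k => s k + t k).
have st := pow_summableD sp tp; have [[s0 _] _] := sp; have [[t0 _] _] := tp.
have [stm _] := st.
split => //.
  by apply: appr_le aS => // [|k]; rewrite ?leq_addr ?lerDl.
by apply: appr_le aT => // [|k]; rewrite ?leq_addl ?lerDr.
Qed.

Lemma has_traceZ X (a : R[i]) (T : X -> X) t :
  has_trace T t -> has_trace (fun x => a *: T x) (a * t).
Proof.
move=> Tt e e0; pose m := cabs a + 1.
have m0 : 0 < m by rewrite ltr_wpDl ?cabs_ge0.
have am : cabs a <= m by rewrite lerDl.
have em0 : 0 < e / m by rewrite divr_gt0.
have [Q [q [[k [phi [x [phib QE qE]]]] [s aT sB] qt]]] := Tt _ em0.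
have [lT s0 _] := aT.
exists (fun y => a *: Q y), (a * q); split.
- exists k, phi, (fun i => a *: x i); split => // [y|].
    by rewrite QE scaler_sumr; apply: eq_bigr => i _; rewrite !scalerA mulrC.
  rewrite qE mulr_sumr; apply: eq_bigr => i _.
  by have [lp _] := phib i; rewrite (linZ lp).
- exists (fun k => m * s k); last first.
    by move=> n; rewrite -mulr_sumr mulrC -ler_pdivlMr.
  have aa : appr 0 (fun=> m) (fun x : X => a *: x).
    apply: appr_of_opb; [|exact: ltW|].
      by move=> b u v; rewrite scalerDr !scalerA mulrC.
    by move=> v; rewrite nrmZ ler_wpM2r ?nrm_ge0.
  have -> : (fun y => a *: T y) - (fun y => a *: Q y) =
      (fun x : X => a *: x) \o (T - Q).
    by apply/funext => y; rewrite /= !fctE scalerBr.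
  exact: appr_comp aa aT.
- rewrite -mulrBr cabsM; apply: le_lt_trans (_ : m * cabs (q - t) < e).
    by rewrite ler_wpM2r ?cabs_ge0.
  by rewrite mulrC -ltr_pdivlMr.
Qed.

End Ideal.

(** * The ring of bounded operators *)

Section BoundedRing.
Variables (R : realType) (Y : normedModType R[i]).

(** Bundling bounded operators gives the noncommutative ring in which the block
   computations take place. *)
Record bop := Bop { bop_fun :> Y -> Y; bopP : bounded_op bop_fun }.

Lemma bop_eq (S T : bop) : (forall y, S y = T y) -> S = T.
Proof.
case: S T => [S bS] [T bT] /= /funext ST; move: bS; rewrite ST => bS.
by congr Bop; apply: Prop_irrelevance.
Qed.

HB.instance Definition _ := gen_eqMixin bop.
HB.instance Definition _ := gen_choiceMixin bop.

Definition bop_zero := Bop (@bounded0 R Y Y).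
Definition bop_opp (T : bop) := Bop (boundedN (bopP T)).
Definition bop_add (S T : bop) := Bop (boundedD (bopP S) (bopP T)).
Definition bop_one := Bop (@bounded_id R Y).
Definition bop_mul (S T : bop) := Bop (bounded_comp (bopP S) (bopP T)).

Lemma bop_lin (T : bop) : linear T. Proof. by case: (bopP T). Qed.

Fact bop_addA : associative bop_add.
Proof. by move=> S T U; apply: bop_eq => y; apply: addrA. Qed.
Fact bop_addC : commutative bop_add.
Proof. by move=> S T; apply: bop_eq => y; apply: addrC. Qed.
Fact bop_add0 : left_id bop_zero bop_add.
Proof. by move=> S; apply: bop_eq => y; apply: add0r. Qed.
Fact bop_addN : left_inverse bop_zero bop_opp bop_add.
Proof. by move=> S; apply: bop_eq => y; apply: addNr. Qed.

HB.instance Definition _ :=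
  GRing.isZmodule.Build bop bop_addA bop_addC bop_add0 bop_addN.

Fact bop_mulA : associative bop_mul.
Proof. by move=> S T U; apply: bop_eq. Qed.
Fact bop_mul1 : left_id bop_one bop_mul.
Proof. by move=> S; apply: bop_eq. Qed.
Fact bop_mulr1 : right_id bop_one bop_mul.
Proof. by move=> S; apply: bop_eq. Qed.
Fact bop_mulDl : left_distributive bop_mul bop_add.
Proof. by move=> S T U; apply: bop_eq. Qed.
Fact bop_mulDr : right_distributive bop_mul bop_add.
Proof. by move=> S T U; apply: bop_eq => y; apply: (linD (bop_lin S)). Qed.

HB.instance Definition _ := GRing.Zmodule_isPzRing.Build bop
  bop_mulA bop_mul1 bop_mulr1 bop_mulDl bop_mulDr.

Lemma bopB_fun (S T : bop) : bop_fun (S - T) = (S : Y -> Y) - T.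
Proof. by []. Qed.

Lemma bopMz (T : bop) (k : int) y : (T *~ k) y = k%:~R *: T y.
Proof.
have nat_case n : (T *+ n) y = T y *+ n.
  by elim: n => // n IH; rewrite !mulrS -IH.
rewrite scaler_int; case: k => n; first exact: nat_case.
by rewrite !NegzE !mulrNz -!pmulrn -nat_case.
Qed.

Lemma appr_exp (T : bop) c s m : appr c s T ->
  exists d, appr d (fun k => s k ^+ m) (T ^+ m).
Proof.
move=> aT; elim: m => [|m [d IH]].
  exists 0%N; rewrite expr0; apply: (@appr_of_opb _ _ _ _ 1) => // y.
  by rewrite mul1r.
exists (c + d)%N; rewrite exprS.
have -> : (fun k => s k ^+ m.+1) = (fun k => s k * s k ^+ m).
  by apply/funext => k; rewrite exprS.
exact: appr_comp aT IH.
Qed.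

End BoundedRing.

(** * Noncommutative algebra of a symmetry and an invertible element *)

Section RingPowers.
Variable A : pzRingType.
Implicit Types x y : A.

Lemma exprMzl (x : A) (k : int) m : (x *~ k) ^+ m = x ^+ m *~ (k ^+ m).
Proof.
elim: m => [|m IH]; first by rewrite !expr0.
by rewrite !exprS IH mulrzAl mulrzAr -mulrzA [k * _]mulrC.
Qed.

(** For m = 0 instead of m.+1 the two sides would be 1 and 2. *)
Lemma exprD_orth (x y : A) m : x * y = 0 -> y * x = 0 ->
  (x + y) ^+ m.+1 = x ^+ m.+1 + y ^+ m.+1.
Proof.
move=> xy yx; elim: m => [|m IH]; first by rewrite !expr1.
have xy' : x * y ^+ m.+1 = 0 by rewrite exprS mulrA xy mul0r.
have yx' : y * x ^+ m.+1 = 0 by rewrite exprS mulrA yx mul0r.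
by rewrite exprS IH mulrDl !mulrDr xy' yx' addr0 add0r -!exprS.
Qed.

Lemma exprM_swap (a b : A) m :
  (b * a) ^+ m.+1 = (b * a) ^+ m * b * a /\ (a * b) ^+ m.+1 = a * ((b * a) ^+ m * b).
Proof.
split; first by rewrite exprSr mulrA.
elim: m => [|m IH]; first by rewrite expr0 mul1r expr1.
by rewrite exprS IH exprS !mulrA.
Qed.

Lemma prod_alternating (C D : A) m :
  \prod_(i < m.*2) (if odd i then D else C) = (C * D) ^+ m.
Proof.
elim: m => [|m IH]; first by rewrite big_ord0.
by rewrite doubleS !big_ord_recr /= IH odd_double /= exprSr mulrA.
Qed.

End RingPowers.

Section Symmetry.
Variables (A : pzRingType) (P U V : A).
Hypotheses (PP : P * P = P) (UV : U * V = 1) (VU : V * U = 1).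

Local Notation Q := (1 - P).
Local Notation F := (P - Q).

Lemma idem_compl_r : P * (1 - P) = 0. Proof. by rewrite mulrBr mulr1 PP subrr. Qed.
Lemma idem_compl_l : (1 - P) * P = 0. Proof. by rewrite mulrBl mul1r PP subrr. Qed.
Lemma idem_compl : (1 - P) * (1 - P) = 1 - P.
Proof. by rewrite mulrBr mulr1 idem_compl_l subr0. Qed.

Definition corner12 (W : A) := P * W * (1 - P).
Definition corner21 (W : A) := (1 - P) * W * P.

(** In blocks relative to 1 = P + (1 - P), the symmetry is diagonal with entries 1
   and -1: its commutators kill diagonal blocks and double the others. *)
Lemma commutator_corners W :
  (P - (1 - P)) * W - W * (P - (1 - P)) = (corner12 W - corner21 W) *+ 2.
Proof.
have PQ1 : P + (1 - P) = 1 by rewrite addrC subrK.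
rewrite mulrBl mulrBr.
have -> : P * W = P * W * P + corner12 W by rewrite -mulrDr PQ1 mulr1.
have -> : (1 - P) * W = corner21 W + (1 - P) * W * (1 - P).
  by rewrite -mulrDr PQ1 mulr1.
have -> : W * P = P * W * P + corner21 W by rewrite /corner21 -!mulrA -mulrDl PQ1 mul1r.
have -> : W * (1 - P) = corner12 W + (1 - P) * W * (1 - P).
  by rewrite /corner12 -!mulrA -mulrDl PQ1 mul1r.
rewrite subrACA (opprD (P * W * P)) addrACA subrr add0r.
by rewrite (opprD (corner12 W)) addrACA subrr addr0 opprB mulr2n.
Qed.

(** The product of two off-diagonal elements is diagonal, and its two blocks are
   orthogonal, so that powers may be taken blockwise; the symmetry then only
   contributes the relative sign. *)
Lemma chern_corners m :
  F * ((F * V - V * F) * (F * U - U * F)) ^+ m.+1 =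
  ((corner12 V * corner21 U) ^+ m.+1 - (corner21 V * corner12 U) ^+ m.+1)
    *~ (- 4) ^+ m.+1.
Proof.
rewrite !commutator_corners.
set a := corner12 V; set b := corner21 V; set a' := corner12 U; set b' := corner21 U.
have aa' : a * a' = 0.
  by rewrite /a /a' /corner12 -!mulrA (mulrA (1 - P) P) idem_compl_l mul0r !mulr0.
have bb' : b * b' = 0.
  by rewrite /b /b' /corner21 -!mulrA (mulrA P (1 - P)) idem_compl_r mul0r !mulr0.
have Pa : P * a = a by rewrite /a /corner12 !mulrA PP.
have Qa : (1 - P) * a = 0 by rewrite /a /corner12 !mulrA idem_compl_l !mul0r.
have Pb : P * b = 0 by rewrite /b /corner21 !mulrA idem_compl_r !mul0r.
have Qb : (1 - P) * b = b by rewrite /b /corner21 !mulrA idem_compl.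
have b'b : b' * b = 0.
  by rewrite /b /b' /corner21 -!mulrA (mulrA P (1 - P)) idem_compl_r mul0r !mulr0.
have a'a : a' * a = 0.
  by rewrite /a /a' /corner12 -!mulrA (mulrA (1 - P) P) idem_compl_l mul0r !mulr0.
clearbody a b a' b'.
have -> : (a - b) *+ 2 * ((a' - b') *+ 2) = (a * b' + b * a') *~ (- 4).
  rewrite mulrnAl mulrnAr -mulrnA mulrBl !mulrBr aa' bb' sub0r subr0 -opprD.
  by rewrite mulrNz -pmulrn mulNrn.
rewrite exprMzl mulrzAr exprD_orth; first last.
- by rewrite -mulrA (mulrA a') a'a mul0r mulr0.
- by rewrite -mulrA (mulrA b') b'b mul0r mulr0.
congr (_ *~ _); rewrite mulrBl !mulrDr !exprS !mulrA Pa Pb Qa Qb.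
by rewrite !mul0r addr0 add0r.
Qed.

Local Notation T := (P * U * P - Q).
Local Notation T' := (P * V * P - Q).

(** The defect is P W W' P - P W P W' P, in which only the corners of W and W'
   remain. *)
Lemma toeplitz_mul (W W' : A) : W * W' = 1 ->
  (P * W * P - (1 - P)) * (P * W' * P - (1 - P)) =
  1 - corner12 W * corner21 W'.
Proof.
move=> WW'.
have PWPQ (Z : A) : P * Z * P * (1 - P) = 0 by rewrite -mulrA idem_compl_r mulr0.
have QPWP (Z : A) : (1 - P) * (P * Z * P) = 0 by rewrite !mulrA idem_compl_l !mul0r.
have expand (a b q : A) : (a - q) * (b - q) = a * b - a * q - (q * b - q * q).
  by rewrite mulrBl !mulrBr.
rewrite expand PWPQ QPWP idem_compl subr0 sub0r opprK.
have -> : corner12 W * corner21 W' = P - P * W * P * (P * W' * P).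
  rewrite /corner12 /corner21 !mulrA -(mulrA _ (1 - P) (1 - P)) idem_compl.
  rewrite mulrBr mulr1 !mulrBl -(mulrA P W W') WW' mulr1 PP.
  by rewrite -(mulrA _ P P) PP.
by rewrite opprB addrCA.
Qed.

(** With z = 1 - TT', the product of 1 - z with a partial geometric sum of z is
   1 - z^m. On the other side T' z = (1 - T'T) T' moves the sum to the left of T'. *)
Lemma toeplitz_parametrix m :
  let S := T' * \sum_(j < m) (corner12 U * corner21 V) ^+ j in
  1 - S * T = (corner12 V * corner21 U) ^+ m /\
  1 - T * S = (corner12 U * corner21 V) ^+ m.
Proof.
move=> S; set x := corner12 V * corner21 U; set z := corner12 U * corner21 V.
have T'T : T' * T = 1 - x by apply: toeplitz_mul.
have TT' : T * T' = 1 - z by apply: toeplitz_mul.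
have swap (t t' : A) : t' * (1 - t * t') = (1 - t' * t) * t'.
  by rewrite mulrBr mulrBl mulr1 mul1r mulrA.
have T'z : T' * z = x * T'.
  have -> : z = 1 - T * T' by rewrite TT' subKr.
  have -> : x = 1 - T' * T by rewrite T'T subKr.
  exact: swap.
have T'zj j : T' * z ^+ j = x ^+ j * T'.
  elim: j => [|j IH]; first by rewrite !expr0 mul1r mulr1.
  by rewrite exprSr mulrA IH -mulrA T'z mulrA -exprSr.
split; last first.
  rewrite /S mulrA TT' -[1 - z]opprB mulNr opprK -subrX1.
  by rewrite addrC subrK.
have -> : S = (\sum_(j < m) x ^+ j) * T'.
  by rewrite /S mulr_sumr mulr_suml; apply: eq_bigr => j _.
rewrite -mulrA T'T mulrBr mulr1.
have -> : (\sum_(j < m) x ^+ j) * x = x * \sum_(j < m) x ^+ j.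
  by rewrite mulr_sumr mulr_suml; apply: eq_bigr => j _; rewrite -exprS -exprSr.
have := subrX1 x m; rewrite mulrBl mul1r => xE.
by rewrite opprB -xE addrC subrK.
Qed.

End Symmetry.

(** * Amplification *)

Section Amplification.
Variables (R : realType) (X : normedModType R[i]) (k : nat).

Definition dsum_inj (i : 'I_k) (x : X) : dsum X k :=
  [ffun l => if l == i then x else 0].
Definition dsum_proj (i : 'I_k) (x : dsum X k) : X := x i.

Lemma dsum_inj_bounded i : bounded_op (dsum_inj i).
Proof.
apply/bounded_opP; split.
  move=> a x y; apply/ffunP => l; rewrite !ffunE.
  by case: (l == i); rewrite ?scaler0 ?addr0.
exists 1 => // x; rewrite mul1r nrm_dsum (bigD1 i)//= ffunE eqxx big1 ?addr0//.
by move=> l /negPf li; rewrite ffunE li nrm0.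
Qed.

Lemma dsum_proj_bounded i : bounded_op (dsum_proj i).
Proof.
apply/bounded_opP; split; first by move=> a x y; rewrite /dsum_proj !ffunE.
by exists 1 => // x; rewrite mul1r; apply: nrm_dsum_ge.
Qed.

Definition matrix_op (t : 'I_k -> 'I_k -> X -> X) : dsum X k -> dsum X k :=
  \sum_i \sum_j (dsum_inj i \o t i j \o dsum_proj j).

Lemma matrix_opE t x i : matrix_op t x i = \sum_j t i j (x j).
Proof.
rewrite /matrix_op fct_sumE sum_ffunE (bigD1 i)//= [X in _ + X]big1 ?addr0.
  rewrite fct_sumE sum_ffunE; apply: eq_bigr => j _.
  by rewrite /= ffunE eqxx.
move=> l /negPf li; rewrite fct_sumE sum_ffunE big1// => j _.
by rewrite /= ffunE eq_sym li.
Qed.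

Lemma matrix_op_bounded t : (forall i j, bounded_op (t i j)) ->
  bounded_op (matrix_op t).
Proof.
move=> bt; rewrite /matrix_op.
elim/big_ind: _ => [|S T|i _]; [exact: bounded0|exact: boundedD|].
elim/big_ind: _ => [|S T|j _]; [exact: bounded0|exact: boundedD|].
apply: bounded_comp; last exact: dsum_proj_bounded.
by apply: bounded_comp => //; apply: dsum_inj_bounded.
Qed.

Lemma matrix_op_Sp p t : (0 < p)%N -> (forall i j, Sp p (t i j)) ->
  Sp p (matrix_op t).
Proof.
move=> p0 bt; rewrite /matrix_op.
elim/big_ind: _ => [|S T|i _]; [exact: Sp0|exact: SpD|].
elim/big_ind: _ => [|S T|j _]; [exact: Sp0|exact: SpD|].
apply: Sp_compr; last exact: dsum_proj_bounded.
by apply: Sp_compl => //; apply: dsum_inj_bounded.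
Qed.

End Amplification.

Section Module.
Variables (R : realType) (A : algType R[i]) (X : completeNormedModType R[i]).
Variables (M : odd_fredholm_module A X).

Lemma amplify_op_bounded k : bounded_op (amplify_op (k := k) (fm_op M)).
Proof.
have -> : amplify_op (fm_op M) =
    matrix_op (fun i j : 'I_k => if i == j then fm_op M else 0).
  apply/funext => x; apply/ffunP => i; rewrite matrix_opE ffunE.
  rewrite (bigD1 i)//= eqxx big1 ?addr0// => j; rewrite eq_sym => /negPf ->.
  by [].
by apply: matrix_op_bounded => i j; case: eqP => _; [exact: fm_op_bounded|exact: bounded0].
Qed.

Lemma amplify_repE k (u : 'M[A]_k) :
  amplify_rep (fm_rep M) u = matrix_op (fun i j => fm_rep M (u i j)).
Proof. by apply/funext => x; apply/ffunP => i; rewrite matrix_opE ffunE. Qed.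

Lemma amplify_rep_bounded k (u : 'M[A]_k) : bounded_op (amplify_rep (fm_rep M) u).
Proof.
by rewrite amplify_repE; apply: matrix_op_bounded => i j; apply: fm_rep_bounded.
Qed.

Lemma amplify_rep_mul k (u v : 'M[A]_k) x :
  amplify_rep (fm_rep M) u (amplify_rep (fm_rep M) v x) =
  amplify_rep (fm_rep M) (u *m v) x.
Proof.
have lrep y : linear ((fun a => fm_rep M a y) : A -> X).
  by move=> l a b; rewrite fm_rep_linear.
apply/ffunP => i; rewrite !ffunE.
under [RHS]eq_bigr do rewrite mxE (lin_sum (lrep _)).
rewrite exchange_big /=; apply: eq_bigr => j _.
have [lu _] := fm_rep_bounded M (u i j).
by rewrite ffunE (lin_sum lu); apply: eq_bigr => l _; rewrite fm_rep_mul.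
Qed.

Lemma amplify_rep1 k x : unital_module M ->
  amplify_rep (fm_rep M) (1%:M : 'M[A]_k) x = x.
Proof.
move=> M1; have lrep y : linear ((fun a => fm_rep M a y) : A -> X).
  by move=> l a b; rewrite fm_rep_linear.
apply/ffunP => i; rewrite ffunE (bigD1 i)//= mxE eqxx M1 big1 ?addr0//.
by move=> j; rewrite mxE eq_sym => /negPf ->; rewrite (lin0 (lrep _)).
Qed.

Lemma amplify_commutator_Sp k p (u : 'M[A]_k) : (0 < p)%N ->
  (forall a, Sp p (commutator (fm_op M) (fm_rep M a))) ->
  Sp p (commutator (amplify_op (fm_op M)) (amplify_rep (fm_rep M) u)).
Proof.
move=> p0 Sa; have [lF _] := fm_op_bounded M.
have -> : commutator (amplify_op (fm_op M)) (amplify_rep (fm_rep M) u) =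
    matrix_op (fun i j => commutator (fm_op M) (fm_rep M (u i j))).
  apply/funext => x; apply/ffunP => i; rewrite matrix_opE !ffunE (lin_sum lF).
  by rewrite -sumrB; apply: eq_bigr => j _; rewrite ffunE.
exact: matrix_op_Sp.
Qed.

End Module.

(** * The index theorem *)

Section IndexTheorem.
Variables (R : realType) (Y : normedModType R[i]).
Hypothesis cY : nrm_complete Y.
Variables (P U V : bop Y).
Hypotheses (PP : P * P = P) (UV : U * V = 1) (VU : V * U = 1).
Local Notation F := (P - (1 - P)).

(** With two off-diagonal corners in each of the m + 1 factors, x^(m+1), y^(m+1) and
   z^(m+1) have the error sequence s^(2m+2), which is summable. The trace of
   y^(m+1) is moved to z^(m+1) by writing both as products of one corner and a
   product of 2m + 1 corners, which in general is not of trace class. *)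
Lemma chern_index m :
  Sp m.+1.*2 (F * U - U * F : bop Y) -> Sp m.+1.*2 (F * V - V * F : bop Y) ->
  exists2 z : int,
    has_index (P * U * P - (1 - P) : bop Y) z &
    app_trace (F * ((F * V - V * F) * (F * U - U * F)) ^+ m.+1 : bop Y) =
      (- 4) ^+ m.+1 * z%:~R.
Proof.
set p := m.+1.*2 => SU SV; have p0 : (0 < p)%N by [].
have half_corner W : 
    corner12 P W = Bop (boundedZ 2^-1 (bopP (P * (F * W - W * F) * (1 - P)))) /\
    corner21 P W = Bop (boundedZ (- 2^-1) (bopP ((1 - P) * (F * W - W * F) * P))).
  rewrite commutator_corners//; split; apply: bop_eq => y.
    have -> : P * ((corner12 P W - corner21 P W) *+ 2) * (1 - P) = corner12 P W *+ 2.
      rewrite mulrnAr mulrnAl (mulrBr P) mulrBl /corner12 /corner21 !mulrA PP.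
      by rewrite idem_compl_r// !mul0r subr0 -(mulrA _ (1 - P) (1 - P)) idem_compl.
    change (corner12 P W y = 2^-1 *: (corner12 P W *~ 2) y); rewrite bopMz.
    by rewrite scalerA mulVf ?scale1r// pnatr_eq0.
  have -> : (1 - P) * ((corner12 P W - corner21 P W) *+ 2) * P = corner21 P W *~ (- 2).
    rewrite mulrnAr mulrnAl (mulrBr (1 - P)) mulrBl /corner12 /corner21 !mulrA.
    rewrite idem_compl_l// !mul0r sub0r -(mulrA _ P P) PP idem_compl//.
    by rewrite mulrNz -pmulrn mulNrn.
  change (corner21 P W y = - 2^-1 *: (corner21 P W *~ (- 2)) y); rewrite bopMz.
  by rewrite scalerA intrN mulrNN mulVf ?scale1r// pnatr_eq0.
have Sp12 W : Sp p (F * W - W * F : bop Y) -> Sp p (corner12 P W : bop Y).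
  move=> SW; have [-> _] := half_corner W.
  have h : bounded_op (fun y : Y => (2^-1 : R[i]) *: y) by apply: boundedZ; apply: bounded_id.
  apply: (Sp_compl (S := fun y => 2^-1 *: y)) => //.
  apply: (Sp_compr (S := P * (F * W - W * F) : bop Y)); last exact: bopP.
  by apply: (Sp_compl SW); apply: bopP.
have Sp21 W : Sp p (F * W - W * F : bop Y) -> Sp p (corner21 P W : bop Y).
  move=> SW; have [_ ->] := half_corner W.
  have h : bounded_op (fun y : Y => (- 2^-1 : R[i]) *: y) by apply: boundedZ; apply: bounded_id.
  apply: (Sp_compl (S := fun y => - 2^-1 *: y)) => //.
  apply: (Sp_compr (S := (1 - P) * (F * W - W * F) : bop Y)); last exact: bopP.
  by apply: (Sp_compl SW); apply: bopP.
have [c1 [s1 [ps1 aV12 aU21]]] := Sp_common (Sp12 _ SV) (Sp21 _ SU).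
have [c2 [s2 [ps2 aV21 aU12]]] := Sp_common (Sp21 _ SV) (Sp12 _ SU).
have power_tclass (S T : bop Y) c s : pow_summable p s -> appr c s S -> appr c s T ->
    exists B, tclass ((S * T) ^+ m.+1 : bop Y) B.
  move=> [_ [B sB]] aS aT.
  have [d ad] := appr_exp m.+1 (appr_comp aS aT : appr _ _ (S * T : bop Y)).
  apply: (tclass_appr_ex (B := B) ad) => n.
  under eq_bigr do rewrite -expr2 -exprM mul2n; exact: sB.
set a := corner12 P V in aV12; set b := corner21 P V in aV21.
set a' := corner12 P U in aU12; set b' := corner21 P U in aU21.
have [B1 xB] := power_tclass a b' _ _ ps1 aV12 aU21.
have [B2 zB] := power_tclass a' b _ _ ps2 aU12 aV21.
have [B3 yB] := power_tclass b a' _ _ ps2 aV21 aU12.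
have [t1 xt] := has_trace_ex xB; have [t2 zt] := has_trace_ex zB.
(* The complementary errors of a' and of (b a')^m b are s and s^(2m+1). *)
have yt : has_trace ((b * a') ^+ m.+1 : bop Y) t2.
  have [ps2m [B sB]] := ps2.
  have [yE zE] := exprM_swap a' b m.
  rewrite zE in zt; rewrite yE.
  have [d ad] := appr_exp m (appr_comp aV21 aU12 : appr _ _ (b * a' : bop Y)).
  apply: (has_trace_comm (C := B) aU12 (appr_comp ad aV21) _ _ zt).
    exact: pow_summable_to0 p0 ps2.
  move=> n; apply: le_trans (sB n); apply: ler_sum => i _.
  by rewrite -expr2 -exprM mulrC -exprSr -exprSr /p mul2n doubleS.
have [S1 S2] := toeplitz_parametrix PP UV VU m.+1.
set T := P * U * P - (1 - P); rewrite -/T in S1 S2.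
set S := _ * \sum_(j < m.+1) _ in S1 S2.
have [z iT tz] : exists2 z : int, has_index T z & t1 - t2 = z%:~R.
  apply: (has_index_trace (S := S) cY (bopP T) (bopP S) (B1 := B1) (B2 := B2)).
  - by have := xB; rewrite -S1.
  - by have := zB; rewrite -S2.
  - by have := xt; rewrite -S1.
  - by have := zt; rewrite -S2.
exists z => //; rewrite chern_corners// -/a -/b -/a' -/b' -tz.
have wt := has_traceB xt yt; have wB := tclassB xB yB.
rewrite -bopB_fun in wt wB; set w := _ - _ in wt wB *.
have -> : bop_fun (w *~ (- 4) ^+ m.+1) = (fun y => (- 4) ^+ m.+1 *: w y).
  by apply/funext => y; rewrite bopMz rmorphXn rmorphN.
have [B' w'B] := tclass_compl wB (boundedZ ((- 4) ^+ m.+1) (@bounded_id R Y)).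
exact: app_traceE w'B (has_traceZ _ wt).
Qed.

End IndexTheorem.

Section Pairing.
Variables (R : realType) (A : algType R[i]) (X : completeNormedModType R[i]).
Variables (M : odd_fredholm_module A X) (u : GL A).
Hypotheses (M1 : unital_module M) (MF : symmetry_module M).

Local Notation Y := (dsum X (gl_size u)).
Let F : bop Y := Bop (amplify_op_bounded M (gl_size u)).
Let U : bop Y := Bop (amplify_rep_bounded M (gl_mx u)).
Let V : bop Y := Bop (amplify_rep_bounded M (gl_inv u)).
Let P : bop Y :=
  Bop (boundedZ 2^-1 (boundedD (@bounded_id _ Y) (bopP F))).

Lemma symmetry_projection : P * P = P /\ F = P - (1 - P).
Proof.
have lF := bop_lin F.
have FF y : F (F y) = y.
  by apply/ffunP => i; rewrite !ffunE MF.
have PE y : P y = 2^-1 *: (y + F y) by [].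
have half (w : Y) : (2^-1 : R[i]) *: (w + w) = w.
  have -> : w + w = 2%:R *: w by rewrite scaler_nat mulr2n.
  by rewrite scalerA mulVf ?scale1r// pnatr_eq0.
split; apply: bop_eq => y.
  have -> : (P * P) y = P (P y) by [].
  rewrite PE; have -> : F (P y) = P y.
    by rewrite !PE (linZ lF) (linD lF) FF addrC.
  exact: half.
have -> : (P - (1 - P)) y = P y - (y - P y) by [].
have -> : P y - (y - P y) = P y + P y - y by rewrite opprB addrA.
by rewrite PE -scalerDr half addrC addKr.
Qed.

Lemma chern_productE m (n := m.*2.+1) :
  chern_product (amplify_op (fm_op M))
    (fun i : 'I_n.+1 => amplify_rep (fm_rep M)
       (if odd i then gl_mx u else gl_inv u)) =
  (F * ((F * V - V * F) * (F * U - U * F)) ^+ m.+1 : bop Y).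
Proof.
rewrite -prod_alternating /chern_product.
pose C (i : nat) : bop Y := if odd i then F * U - U * F else F * V - V * F.
transitivity (bop_fun F \o bop_fun (\prod_(i < n.+1) C i)); last by [].
congr (_ \o _).
have -> : bop_fun (\prod_(i < n.+1) C i) =
    \big[(fun S T : Y -> Y => S \o T)/idfun]_(i < n.+1) bop_fun (C i).
  exact: (big_morph (fun T : bop Y => bop_fun T)).
apply: eq_bigr => i _; rewrite /C; by case: (odd i).
Qed.

Lemma index_pairing_chern (q : R) m (n := m.*2.+1) : 0 < q -> q <= n.+1%:R ->
  q_summable q M ->
  app_trace (chern_product (amplify_op (fm_op M))
    (fun i : 'I_n.+1 => amplify_rep (fm_rep M)
       (if odd i then gl_mx u else gl_inv u))) =
  (- 4) ^+ m.+1 * (index_pairing u M)%:~R.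
Proof.
move=> q0 qn Mq; rewrite chern_productE.
have [PP FP] := symmetry_projection.
have UV : U * V = 1.
  apply: bop_eq => y.
  transitivity (amplify_rep (fm_rep M) (1%:M : 'M[A]_(gl_size u)) y).
    by rewrite -(gl_mulV u) -amplify_rep_mul.
  exact: amplify_rep1.
have VU : V * U = 1.
  apply: bop_eq => y.
  transitivity (amplify_rep (fm_rep M) (1%:M : 'M[A]_(gl_size u)) y).
    by rewrite -(gl_mulVl u) -amplify_rep_mul.
  exact: amplify_rep1.
have cY : nrm_complete Y by apply/dsum_nrm_complete/complete_nrm_complete.
have S a : Sp m.+1.*2 (commutator (fm_op M) (fm_rep M a)).
  by apply: Sp_of_S_app q0 _ (Mq a); rewrite doubleS.
have SU : Sp m.+1.*2 (F * U - U * F : bop Y).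
  exact: (@amplify_commutator_Sp _ _ _ M _ _ (gl_mx u) _ S).
have SV : Sp m.+1.*2 (F * V - V * F : bop Y).
  exact: (@amplify_commutator_Sp _ _ _ M _ _ (gl_inv u) _ S).
rewrite FP in SU SV *.
have [z iz ->] := chern_index cY PP UV VU SU SV.
congr (_ * _%:~R); rewrite /index_pairing.
apply/esym/fredholm_indexE => //.
exact: (bop_lin (P * U * P - (1 - P))).
Qed.

End Pairing.

Unset Implicit Arguments.
Local Close Scope classical_set_scope.

Theorem theorem6p6 (R : realType) (A : algType R[i]) (q : R)
    (X : completeNormedModType R[i]) (M : odd_fredholm_module A X)
    (B : completeNormedModType R[i] -> Prop) (BX : B X)
    (u : GL A) (n : nat) (c : R[i]) :
  0 < q -> q_summable q M -> unital_module M -> symmetry_module M ->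
  stable_countable_sums B -> contains_zero_space B ->
  odd n -> q <= n.+1%:R -> c != 0 ->
  let uinv_u : 'I_n.+1 -> 'M[A]_(gl_size u) :=
    fun i => if odd i then gl_mx u else gl_inv u in
  let rhs : R[i] :=
    (-1) ^+ (n.+1)./2 / (4 ^+ (n.+1)./2 * c) *
    chern_character c (amplify_rep (fm_rep M)) (amplify_op (fm_op M)) uinv_u in
  (index_pairing u M)%:~R = rhs /\
  forall (N : banach_algebra_norm A) (pairing : K1 N -> K1hom A B -> int),
    is_K_pairing pairing ->
    (pairing (K1_class N u) (K1hom_class (ModuleOver BX M)))%:~R = rhs.
Proof.
move=> q0 Mq M1 MF _ _ n_odd qn c0 uinv_u rhs.
suff rhsE : (index_pairing u M)%:~R = rhs.
  by split => // N pairing [_ pairingE]; rewrite pairingE.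
rewrite {}/rhs {}/uinv_u.
have [m nE] : exists m, n = m.*2.+1.
  by exists n./2; rewrite -[LHS]odd_double_half n_odd.
subst n; rewrite /chern_character (index_pairing_chern u M1 MF q0 qn Mq).
rewrite -doubleS doubleK.
have four0 : (4 : R[i]) ^+ m.+1 != 0 by rewrite expf_neq0// pnatr_eq0.
have -> : (- 4 : R[i]) ^+ m.+1 = (-1) ^+ m.+1 * 4 ^+ m.+1 by rewrite -exprMn mulN1r.
move: (index_pairing u M)%:~R => z.
have := sqrr_sign R[i] m.+1; move: four0.
move: ((-1) ^+ m.+1 : R[i]) (4 ^+ m.+1 : R[i]) => e f f0 e1.
rewrite -[LHS]mul1r -e1.
by field; apply/andP.
Qed.
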